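(* Let $\bar{\bar d}$ be the quotient pseudometric on the space $\bar{\bar X}=\bar X/G$ of unordered tree-like shapes induced by either $\bar d_1$ or $\bar d_2$ on $\bar X$. Then $\bar{\bar d}$ is a metric and $(\bar{\bar X},\bar{\bar d})$ is a contractible, complete, proper geodesic space. The same holds for restricted tree-spaces: let $Z\subset X$ be a restricted pre-shape space which is saturated with respect to the reordering group $G$. Then, for the corresponding restricted tree-space $\bar{\bar Z}=\bar Z/G\subset\bar{\bar X}$, the quotient pseudometric $\bar{\bar d}_Z$ is a metric and $(\bar{\bar Z},\bar{\bar d}_Z)$ is a contractible, complete, proper geodesic space.
   Context: Setting. Fix integers $d,n\ge 1$ (in the paper $d=2$ or $3$) and a finite rooted ordered (planar) binary tree $\mathscr T=(V,E,r)$ with $E\neq\emptyset$: every non-leaf vertex has exactly two children, and the children of each vertex are totally ordered. The tree pre-shape space is the vector space $X=\prod_{e\in E}(\mathbb R^d)^n$, with elements $x=(x_e)_{e\in E}$. On $X$ consider the metrics $d_1(x,y)=\sum_{e\in E}\|x_e-y_e\|$ and $d_2(x,y)=\sqrt{\sum_{e\in E}\|x_e-y_e\|^2}$, where $\|\cdot\|$ is the Euclidean norm on $(\mathbb R^d)^n$. Equivalence. For $x\in X$, the collapsed tree of $x$ is the rooted ordered tree with edge attributes obtained from $\mathscr T$ by contracting every edge $e$ with $x_e=0$ (when an edge from $u$ down to $v$ is contracted, the children of $v$ are inserted, in order, at the position of $v$ among the children of $u$) and keeping the attribute $x_e$ on each remaining edge. Put $x\sim y$ iff the collapsed trees of $x$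 and $y$ are isomorphic as rooted ordered trees with edge attributes. The space of ordered tree-like shapes is $\bar X=X/\sim$; write $\bar x$ for the class of $x$. Quotient pseudometric. If $(Y,\rho)$ is a metric space with an equivalence relation $\approx$, the quotient pseudometric on $Y/\approx$ is $$\bar\rho([x],[y])=\inf\Big\{\sum_{i=1}^k \rho(x_i,y_i)\ :\ k\ge 1,\ x_1\in[x],\ y_i\approx x_{i+1}\ (1\le i<k),\ y_k\in[y]\Big\}.$$ $\bar d_1,\bar d_2$ are the quotient pseudometrics on $\bar X$ induced by $d_1,d_2$; they are metrics. Unordered tree-shapes. $G$ is the finite group of reorderings of $\mathscr T$, i.e. of automorphisms of $\mathscr T$ as a rooted tree when the sibling orders are forgotten; it acts on $X$ by permuting the edge coordinates. $\bar{\bar X}=\bar X/G$ is the quotient of $\bar X$ by the equivalence relation generated by $\bar x\approx\overline{g x}$ for $x\in X$, $g\in G$, with quotient pseudometric $\bar{\bar d}$ induced by $\bar d$. Restricted spaces. A subset $E'\subset E$ determines a combinatorial ordered rooted tree (its topology) by contracting in $\mathscr T$ all edges outside $E'$. Let $\mathcal E$ be a nonempty family of subsets of $E$ such that if $E'\in\mathcal E$ and $E''\subset E$ determines the same ordered topology as $E'$, then $E''\in\mathcal E$. The associated restricted pre-shape space is $Z=\bigcup_{E'\in\mathcal E}\{x\in X: x_e=0\text{ for }e\notin E'\}$. For $d\in\{d_1,d_2\}$, $Z$ carries the metric $d_Z$ induced by $d$ (the length metric: infimum of $d$-lengths of paths in $Z$), $\bar Z=Z/\sim_Z$ where $\sim_Z$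 is the restriction of $\sim$ to $Z$, and $\bar d_Z$ is the quotient pseudometric on $\bar Z$ induced by $d_Z$. $Z$ is saturated with respect to $G$ if for every topology appearing in $\mathcal E$, every subset of $E$ whose topology is a reordering of siblings of that topology also lies in $\mathcal E$. In that case $\bar{\bar Z}=\bar Z/G$ is the image of $\bar Z$ in $\bar{\bar X}$ (the quotient of $\bar Z$ by the restriction of $\approx$), and $\bar{\bar d}_Z$ is the quotient pseudometric on $\bar{\bar Z}$ induced by $\bar d_Z$. A metric space is proper if its closed bounded subsets are compact; it is geodesic if any two points are joined by a path whose length equals their distance. *)

(* Defs.v *)
From HB Require Import structures.
From Stdlib Require Import Relation_Operators.
From mathcomp Require Import all_boot all_order all_algebra all_fingroup.
From mathcomp Require Import generic_quotient.
From mathcomp Require Import all_classical all_reals all_analysis.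

Set Implicit Arguments.
Unset Strict Implicit.
Unset Printing Implicit Defensive.

Import Order.TTheory GRing.Theory Num.Theory.
Import numFieldNormedType.Exports.

Local Open Scope classical_set_scope.
Local Open Scope ring_scope.
Local Open Scope quotient_scope.

Section Paths.
Context {R : realType} {T : Type} (rho : T -> T -> R).

Record is_metric : Prop := IsMetric {
  is_metric_xx : forall x, rho x x = 0;
  is_metric_eq : forall x y, rho x y = 0 -> x = y;
  is_metric_sym : forall x y, rho x y = rho y x;
  is_metric_triangle : forall y x z, rho x z <= rho x y + rho y z }.

(* Paths are parametrized by [0, 1]; their values elsewhere are irrelevant.
   Continuity is meant with respect to [rho]. *)
Record is_path (a b : T) (gamma : R -> T) : Prop := IsPath {
  path_start : gamma 0 = a;
  path_end : gamma 1 = b;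
  path_continuous : forall t, t \in `[0, 1] ->
    rho (gamma s) (gamma t) @[s --> within `[0, 1] (nbhs t)] --> (0 : R) }.

Definition path_length (gamma : R -> T) : \bar R :=
  ereal_sup [set (\sum_(0 <= i < size s)
                    rho (gamma (nth 1 (0 :: s) i))
                        (gamma (nth 1 (0 :: s) i.+1)))%:E
            | s in [set s | itv_partition 0 1 s]].

(* [fine] only discards the value +oo, which arises when no path of finite
   length joins [a] to [b]; in a union of linear subspaces, the broken segment
   through 0 is such a path. *)
Definition length_metric (a b : T) : R :=
  fine (ereal_inf [set path_length gamma | gamma in [set g | is_path a b g]]).

End Paths.

Definition metric_space (R : realType) (T : choiceType) (rho : T -> T -> R)
  (rhoP : is_metric rho) : Type := T.

Section MetricSpace.
Context (R : realType) (T : choiceType) (rho : T -> T -> R).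
Context (rhoP : is_metric rho).

HB.instance Definition _ := Choice.copy (metric_space rhoP) T.
HB.instance Definition _ := @isMetric.Build R (metric_space rhoP) rho
  (is_metric_xx rhoP) (is_metric_eq rhoP) (is_metric_sym rhoP)
  (is_metric_triangle rhoP).

End MetricSpace.

Section MetricProperties.
Context (R : realType) (M : metricType R).

Definition contractible_space : Prop :=
  exists (x0 : M) (h : M * R -> M),
    [/\ {within [set p | p.2 \in `[0, 1]], continuous h},
        forall x, h (x, 0) = x & forall x, h (x, 1) = x0].

Definition complete_space : Prop :=
  forall F : set_system M, ProperFilter F -> cauchy F -> exists x : M, F --> x.

Definition proper_space : Prop :=
  forall A : set M, closed A ->
    (exists r : R, forall x y, A x -> A y -> mdist x y <= r) -> compact A.

Definition geodesic_space : Prop :=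
  forall x y : M, exists gamma : R -> M,
    is_path mdist x y gamma /\ path_length mdist gamma = (mdist x y)%:E.

End MetricProperties.

Definition metric_contractible_complete_proper_geodesic
    (R : realType) (T : choiceType) (rho : T -> T -> R) : Prop :=
  exists rhoP : is_metric rho,
    let M : metricType R := metric_space rhoP in
    [/\ contractible_space M, complete_space M, proper_space M
      & geodesic_space M].

(* The chain has k + 1 links. *)
Definition quotient_dist (R : realType) (T : choiceType) (e : equiv_rel T)
    (rho : T -> T -> R) (a b : {eq_quot e}) : R :=
  inf [set s | exists (k : nat) (x y : nat -> T),
    [/\ \pi_{eq_quot e} (x 0%N) = a,
        forall i, (i < k)%N -> e (y i) (x i.+1),
        \pi_{eq_quot e} (y k) = b
      & s = \sum_(0 <= i < k.+1) rho (x i) (y i)]].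

Section Equivalences.
Context {T : choiceType}.

Section Kernel.
Context {U : Type} (f : T -> U).

Definition kernel_rel : rel T := fun x y => `[< f x = f y >].

Lemma kernel_refl : reflexive kernel_rel.
Proof. by move=> x; apply/asboolP. Qed.

Lemma kernel_sym : symmetric kernel_rel.
Proof. by move=> x y; apply/asboolP/asboolP. Qed.

Lemma kernel_trans : transitive kernel_rel.
Proof. by move=> y x z /asboolP xy /asboolP yz; apply/asboolP; rewrite xy. Qed.

Definition kernel_equiv : equiv_rel T :=
  EquivRel kernel_rel kernel_refl kernel_sym kernel_trans.

End Kernel.

Section Generated.
Variable r : T -> T -> Prop.

Definition generated_rel : rel T := fun x y => `[< clos_refl_sym_trans T r x y >].

Lemma generated_refl : reflexive generated_rel.
Proof. by move=> x; apply/asboolP; exact: rst_refl. Qed.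

Lemma generated_sym : symmetric generated_rel.
Proof. by move=> x y; apply/asboolP/asboolP; exact: rst_sym. Qed.

Lemma generated_trans : transitive generated_rel.
Proof.
by move=> y x z /asboolP xy /asboolP yz; apply/asboolP; exact: rst_trans xy yz.
Qed.

Definition generated_equiv : equiv_rel T :=
  EquivRel generated_rel generated_refl generated_sym generated_trans.

End Generated.

Section Restriction.
Context {U : Type} (f : T -> U) (e : equiv_rel U).

Definition restrict_rel : rel T := fun x y => e (f x) (f y).

Lemma restrict_refl : reflexive restrict_rel.
Proof. by move=> x; exact: generic_quotient.equiv_refl. Qed.

Lemma restrict_sym : symmetric restrict_rel.
Proof. by move=> x y; exact: generic_quotient.equiv_sym. Qed.

Lemma restrict_trans : transitive restrict_rel.
Proof. by move=> y x z; exact: generic_quotient.equiv_trans. Qed.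

Definition restrict_equiv : equiv_rel T :=
  EquivRel restrict_rel restrict_refl restrict_sym restrict_trans.

End Restriction.
End Equivalences.

Inductive btree : Type := BLeaf | BNode of btree & btree.

(* An edge of [BNode l r] is [inl v] or [inr v] for a vertex v of l, r: its
   lower endpoint. A vertex of a tree is [None], the root, or [Some e], the
   lower endpoint of the edge e. *)
Fixpoint edge (t : btree) : finType :=
  match t with
  | BLeaf => void
  | BNode l r => (option (edge l) + option (edge r))%type
  end.

(* The upper endpoint of an edge; the top edge of a branch of [BNode l r] has
   upper endpoint [None]. *)
Fixpoint parent (t : btree) : edge t -> option (edge t) :=
  match t with
  | BLeaf => fun e => match e with end
  | BNode l r => fun e =>
      match e with
      | inl v => omap (fun e' => inl (parent e')) v
      | inr v => omap (fun e' => inr (parent e')) v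
      end
  end.

(* Automorphisms of the rooted tree, as permutations of the non-root vertices,
   that is, of the edges. *)
Definition reorderings (t : btree) : {set {perm edge t}} :=
  [set g : {perm edge t} | [forall e, parent (g e) == omap g (parent e)]]%SET.

Lemma reorderings_group_set (t : btree) : group_set (reorderings t).
Proof.
apply/group_setP; split=> [|g h].
  by rewrite inE; apply/forallP => e; rewrite !perm1; case: parent => //= ?;
    rewrite perm1.
rewrite !inE => /forallP gP /forallP hP; apply/forallP => e.
rewrite permM (eqP (hP _)) (eqP (gP _)).
by case: (parent e) => //= ?; rewrite permM.
Qed.

Canonical reordering_group (t : btree) := Group (reorderings_group_set t).

(* Rooted ordered trees with edge attributes in [A]: the list of the edges at
   the root, with the subtrees below them. Isomorphism of such trees is
   equality of their encodings. *)
Inductive otree (A : Type) : Type := ONode of seq (A * otree A).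

Definition branches A (c : otree A) : seq (A * otree A) :=
  let: ONode s := c in s.

(* The children contributed by an edge with attribute [a] above the subtree
   [c]; an edge without an attribute is contracted. *)
Definition branch A (a : option A) (c : otree A) : seq (A * otree A) :=
  if a is Some a' then [:: (a', c)] else branches c.

Fixpoint contract_edges A (t : btree) : (edge t -> option A) -> otree A :=
  match t with
  | BLeaf => fun _ => ONode [::]
  | BNode l r => fun x =>
      ONode (branch (x (inl None)) (contract_edges (fun e => x (inl (Some e)))) ++
             branch (x (inr None)) (contract_edges (fun e => x (inr (Some e)))))
  end.

Inductive sibling_reordering A : otree A -> otree A -> Prop :=
| reorder_refl c : sibling_reordering c c
| reorder_trans c1 c2 c3 : sibling_reordering c1 c2 ->
    sibling_reordering c2 c3 -> sibling_reordering c1 c3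
| reorder_swap s1 b1 b2 s2 :
    sibling_reordering (ONode (s1 ++ b1 :: b2 :: s2))
                       (ONode (s1 ++ b2 :: b1 :: s2))
| reorder_below s1 a c c' s2 : sibling_reordering c c' ->
    sibling_reordering (ONode (s1 ++ (a, c) :: s2))
                       (ONode (s1 ++ (a, c') :: s2)).

Definition topology_of (t : btree) (E : {set edge t}) : otree unit :=
  contract_edges (fun e => if e \in E then Some tt else None).

Section Shapes.
Context {R : realType} {n d : nat} {t : btree}.

(* A vector of (R^d)^n is a matrix whose rows are its n components. *)
Local Notation attribute := 'M[R]_(n, d).
Local Notation X := {ffun edge t -> attribute}.

Definition euclidean_norm (a : attribute) : R :=
  Num.sqrt (\sum_i \sum_j a i j ^+ 2).

Definition d1 (x y : X) : R := \sum_e euclidean_norm (x e - y e).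

Definition d2 (x y : X) : R :=
  Num.sqrt (\sum_e euclidean_norm (x e - y e) ^+ 2).

Definition collapsed_tree (x : X) : otree attribute :=
  contract_edges (fun e => if x e == 0 then None else Some (x e)).

Definition shape_equiv : equiv_rel X := kernel_equiv collapsed_tree.

Definition shape := {eq_quot shape_equiv}.
HB.instance Definition _ := Choice.on shape.

Definition reorder_act (g : {perm edge t}) (x : X) : X :=
  [ffun e => x (g^-1%g e)].

Definition reordering_equiv : equiv_rel shape :=
  generated_equiv (fun a b : shape => exists (x : X) (g : {perm edge t}),
    [/\ g \in reorderings t, a = \pi_{eq_quot shape_equiv} x
      & b = \pi_{eq_quot shape_equiv} (reorder_act g x)]).

Definition shape_dist (dist : X -> X -> R) : shape -> shape -> R :=
  quotient_dist dist.

Definition unordered_shape := {eq_quot reordering_equiv}.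
HB.instance Definition _ := Choice.on unordered_shape.

Definition unordered_shape_dist (dist : X -> X -> R) :
    unordered_shape -> unordered_shape -> R :=
  quotient_dist (shape_dist dist).

End Shapes.
Arguments shape : clear implicits.
Arguments unordered_shape : clear implicits.

Definition restricting_family (t : btree) (EE : {set {set edge t}}) : Prop :=
  EE != finset.set0 /\
  forall E1 E2 : {set edge t}, E1 \in EE ->
    topology_of E2 = topology_of E1 -> E2 \in EE.

Definition saturated (t : btree) (EE : {set {set edge t}}) : Prop :=
  forall E1 E2 : {set edge t}, E1 \in EE ->
    sibling_reordering (topology_of E1) (topology_of E2) -> E2 \in EE.

Section RestrictedShapes.
Context (R : realType) (n d : nat) (t : btree) (EE : {set {set edge t}}).
Local Notation X := {ffun edge t -> 'M[R]_(n, d)}.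

Definition in_restricted : pred X := fun x =>
  [exists E1 in EE, [forall e, (e \notin E1) ==> (x e == 0)]].

Definition restricted_preshape := {x : X | in_restricted x}.
HB.instance Definition _ := Choice.on restricted_preshape.

Definition restricted_preshape_dist (dist : X -> X -> R) :
    restricted_preshape -> restricted_preshape -> R :=
  length_metric (fun u v => dist (val u) (val v)).

Definition restricted_shape_equiv : equiv_rel restricted_preshape :=
  restrict_equiv val (@shape_equiv R n d t).

Definition restricted_shape := {eq_quot restricted_shape_equiv}.
HB.instance Definition _ := Choice.on restricted_shape.

Definition restricted_shape_dist (dist : X -> X -> R) :
    restricted_shape -> restricted_shape -> R :=
  quotient_dist (restricted_preshape_dist dist).

Definition restricted_shape_incl (a : restricted_shape) : shape R n d t :=
  \pi_{eq_quot (@shape_equiv R n d t)} (val (repr a)).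

Definition restricted_reordering_equiv : equiv_rel restricted_shape :=
  restrict_equiv restricted_shape_incl (@reordering_equiv R n d t).

Definition restricted_unordered_shape :=
  {eq_quot restricted_reordering_equiv}.
HB.instance Definition _ := Choice.on restricted_unordered_shape.

Definition restricted_unordered_shape_dist (dist : X -> X -> R) :
    restricted_unordered_shape -> restricted_unordered_shape -> R :=
  quotient_dist (restricted_shape_dist dist).

End RestrictedShapes.

(* Main.v *)
(* Two preshapes of the same unordered shape differ by a permutation of the
   edges, and the same permutation relates all preshapes obtained from them by
   contracting further edges. An identification in a chain can therefore be
   applied to every preshape whose support is contained in that of the chain.
   Near a preshape x supports only grow, so a chain starting at x and shorter
   than its smallest nonzero coordinate can be replaced by a single segment from
   a preshape equivalent to x; as the classes are finite, the quotient
   pseudometric is a metric. The same remark shows that a path in a restricted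
   preshape space can be subdivided until consecutive points lie in a common
   coordinate subspace; hence in both cases the quotient metric is the infimum
   of the lengths of chains of straight segments.
   The norm is invariant under the equivalence and 1-Lipschitz on the quotient,
   so the closed balls about 0 are compact, as are all their closed subsets:
   the space is proper and therefore complete. A segment chain of length l gives
   an l-Lipschitz path, and the paths given by nearly minimal chains have a limit
   along an ultrafilter, which is a geodesic. Scaling preshapes contracts the
   quotient to 0. *)
Require Import Defs.
From Stdlib Require Import Relation_Operators.
From mathcomp Require Import all_boot all_order all_algebra all_fingroup.
From mathcomp Require Import generic_quotient.
From mathcomp Require Import all_classical all_reals all_analysis.
From mathcomp Require Import ring lra.

Set Implicit Arguments.
Unset Strict Implicit.
Unset Printing Implicit Defensive.

Import Order.TTheory GRing.Theory Num.Theory.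
Import numFieldNormedType.Exports.

Local Open Scope classical_set_scope.
Local Open Scope ring_scope.
Local Open Scope quotient_scope.

(** * Equivalent preshapes *)

Section OrderedTrees.

(** Subtrees occur inside a list, so the induction carries a second predicate [Q] for forests. *)
Lemma otree_nested_ind (A : Type) (P : otree A -> Prop)
    (Q : seq (A * otree A) -> Prop) :
  Q [::] -> (forall a c s, P c -> Q s -> Q ((a, c) :: s)) ->
  (forall s, Q s -> P (ONode s)) -> forall c, P c.
Proof.
move=> Q0 QS PQ; fix IH 1 => -[s]; apply: PQ.
elim: s => [|[a c] s IHs]; first exact: Q0.
by apply: QS => //; exact: IH.
Qed.

Fixpoint contract_tree (A B : Type) (f : A -> option B) (c : otree A) : otree B :=
  let: ONode s := c in
  ONode (flatten [seq branch (f p.1) (contract_tree f p.2) | p <- s]).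

Fixpoint labels (A : Type) (c : otree A) : seq A :=
  let: ONode s := c in flatten [seq p.1 :: labels p.2 | p <- s].

(** Contraction can be done in two stages: a preshape is first collapsed with edge names as labels,
    and attributes are substituted afterwards. *)
Lemma contract_contract_edges (A B : Type) (f : A -> option B) (t : btree)
    (x : edge t -> option A) :
  contract_tree f (contract_edges x) = contract_edges (fun e => obind f (x e)).
Proof.
have branchE a c : flatten [seq branch (f p.1) (contract_tree f p.2) | p <- branch a c]
    = branch (obind f a) (contract_tree f c).
  by case: a => [a|] /=; [rewrite cats0 | case: c].
elim: t x => [|l IHl r IHr] x //=.
by rewrite map_cat flatten_cat !branchE IHl IHr.
Qed.

Lemma labels_contract_edges (A : eqType) (t : btree) (x : edge t -> option A) :
  (forall e e' a, x e = Some a -> x e' = Some a -> e = e') ->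
  uniq (labels (contract_edges x)) /\
  forall a, a \in labels (contract_edges x) <-> exists e, x e = Some a.
Proof.
have branchE b c : flatten [seq p.1 :: labels p.2 | p <- branch b c]
    = (if b is Some a then [:: a] else [::]) ++ labels c :> seq A.
  by case: b => [b|] /=; [rewrite cats0 | case: c].
elim: t x => [|l IHl r IHr] x xinj /=; first by split=> // a; split=> // -[].
rewrite map_cat flatten_cat !branchE.
have [|ul inl_] := IHl (fun e => x (inl (Some e))).
  by move=> e e' a xe xe'; have [] := xinj _ _ _ xe xe'.
have [|ur inr_] := IHr (fun e => x (inr (Some e))).
  by move=> e e' a xe xe'; have [] := xinj _ _ _ xe xe'.
have memtop (o : option A) a : (a \in (if o is Some a then [:: a] else [::])) = (o == Some a).
  by case: o => [b|] //; rewrite inE eq_sym.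
split.
  have utop (o : option A) : uniq (if o is Some a then [:: a] else [::]) by case: o.
  rewrite cat_uniq (cat_uniq _ (labels _)) cat_uniq !utop ul ur /= !andbT.
  apply/and3P; split.
  - apply/hasPn => a /inl_ [e xe]; rewrite memtop; apply/eqP => x0.
    by have := xinj _ _ _ x0 xe.
  - apply/hasPn => a; rewrite !mem_cat !memtop => /orP[/eqP xr|/inr_[e xe]].
      apply/negP => /orP[/eqP xl|/inl_[e' xe']]; first by have := xinj _ _ _ xl xr.
      by have := xinj _ _ _ xe' xr.
    apply/negP => /orP[/eqP xl|/inl_[e' xe']]; first by have := xinj _ _ _ xl xe.
    by have := xinj _ _ _ xe' xe.
  - apply/hasPn => a /inr_ [e xe]; rewrite memtop; apply/eqP => x0.
    by have := xinj _ _ _ x0 xe.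
move=> a; rewrite !mem_cat !memtop; split.
  move=> /orP[/orP[/eqP|/inl_[e]]|/orP[/eqP|/inr_[e]]] xe; first by exists (inl None).
  - by exists (inl (Some e)).
  - by exists (inr None).
  - by exists (inr (Some e)).
move=> [[[e|]|[e|]] xe].
- by apply/orP; left; apply/orP; right; apply/inl_; exists e.
- by rewrite xe eqxx.
- by apply/orP; right; apply/orP; right; apply/inr_; exists e.
- by rewrite xe eqxx ?orbT.
Qed.

Lemma cat_size_inj (A : Type) (s1 s2 t1 t2 : seq A) :
  s1 ++ t1 = s2 ++ t2 -> size s1 = size s2 -> s1 = s2 /\ t1 = t2.
Proof.
move=> st s12; split.
  by rewrite -[s1](take_size_cat t1 erefl) st s12 take_size_cat.
by rewrite -[t1](drop_size_cat t1 (erefl (size s1))) st s12 drop_size_cat.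
Qed.

(** Equal relabellings force equal underlying ordered trees, and over a fixed ordered tree a
    contraction depends only on the depth-first list of what happens to the labels. The freedom in
    [h] and [h'] later transfers an equivalence to all further contractions. *)
Lemma contract_tree_shape (A A' C : Type) (f : A -> C) (g : A' -> C)
    (c : otree A) (c' : otree A') :
  contract_tree (Some \o f) c = contract_tree (Some \o g) c' ->
  map f (labels c) = map g (labels c') /\
  forall (B : Type) (h : A -> option B) (h' : A' -> option B),
    map h (labels c) = map h' (labels c') ->
    contract_tree h c = contract_tree h' c'.
Proof.
move: c c'; apply: (@otree_nested_ind A _ (fun s => forall s',
  contract_tree (Some \o f) (ONode s) = contract_tree (Some \o g) (ONode s') ->
  map f (labels (ONode s)) = map g (labels (ONode s')) /\
  forall (B : Type) (h : A -> option B) (h' : A' -> option B),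
    map h (labels (ONode s)) = map h' (labels (ONode s')) ->
    contract_tree h (ONode s) = contract_tree h' (ONode s'))).
- by case=> [|[a c] s'].
- move=> a c s IHc IHs [|[a' c'] s'] // [fa cc' ss'].
  have [fc hc] := IHc _ cc'.
  have [fs hs] := IHs s' (f_equal _ ss').
  split; first by rewrite /= !map_cat fa fc; congr (_ :: _ ++ _).
  (* By [fc] the label lists of the first subtrees have equal length, so both concatenations split
     at the same place. *)
  move=> B h h' /=; rewrite !map_cat => -[ha] /cat_size_inj[|lc ls].
    by have := congr1 size fc; rewrite !size_map.
  have [es] := hs _ _ _ ls.
  by rewrite ha es (hc _ _ _ lc).
- by move=> s IHs [s'] /IHs.
Qed.

(** Each sequence is completed to an enumeration of [T] by its missing elements; [g] matches the two
    enumerations position by position. *)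
Lemma perm_map_seq (T : finType) (s s' : seq T) :
  uniq s -> uniq s' -> size s = size s' -> exists g : {perm T}, map g s = s'.
Proof.
have cpl (u : seq T) : uniq u -> uniq (u ++ [seq e <- enum T | e \notin u]) /\
    perm_eq (u ++ [seq e <- enum T | e \notin u]) (enum T).
  move=> uu; suff uq : uniq (u ++ [seq e <- enum T | e \notin u]).
    split=> //; apply: uniq_perm => //; first exact: enum_uniq.
    by move=> e; rewrite mem_cat mem_filter mem_enum; case: (e \in u).
  rewrite cat_uniq uu filter_uniq ?enum_uniq// andbT.
  by apply/hasPn => e; rewrite mem_filter => /andP[].
move=> us us' szs.
have [u1 p1] := cpl _ us; have [u2 p2] := cpl _ us'.
set w := _ ++ _ in u1 p1; set w' := _ ++ _ in u2 p2.
have szw : size w = size w' by rewrite (perm_size p1) (perm_size p2).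
have inw e : e \in w by rewrite (perm_mem p1) mem_enum.
have finj : injective (fun e => nth e w' (index e w)).
  move=> e1 e2 /eqP.
  have ie (e : T) : (index e w < size w')%N by rewrite -szw index_mem.
  rewrite (set_nth_default e2) // nth_uniq // => /eqP ee.
  by rewrite -(nth_index e2 (inw e1)) ee nth_index.
exists (perm finj); case: s szs @w @w' {u2 p2 cpl us us'} szw inw finj u1 p1 =>
  [|e0 s] szs w w' szw inw finj u1 p1.
  by case: s' szs w' szw inw finj.
apply: (@eq_from_nth _ e0); rewrite size_map // => i lti.
rewrite (nth_map e0) // permE.
have -> : nth e0 (e0 :: s) i = nth e0 w i by rewrite nth_cat lti.
rewrite index_uniq // ?size_cat ?(leq_trans lti) ?leq_addr//.
by rewrite (set_nth_default e0) ?nth_cat -?szs ?lti// size_cat -szs (leq_trans lti) ?leq_addr.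
Qed.

End OrderedTrees.

(** * Permutations of edges that carry equivalences of preshapes *)

Section ShapeEquivalence.
Context {R : realType} {n d : nat} {t : btree}.
Local Notation X := {ffun edge t -> 'M[R]_(n, d)}.
Implicit Types x y z : X.

Definition supp_le x y : Prop := forall e, y e = 0 -> x e = 0.

(** Every edge contracted for [y] is contracted for [x] too, so [x] can be collapsed starting from
    the collapse of [y] with edges labelled by themselves. *)
Lemma collapsed_treeE x y : supp_le x y ->
  collapsed_tree x = contract_tree (fun e => if x e == 0 then None else Some (x e))
    (contract_edges (fun e => if y e == 0 then None else Some e)).
Proof.
move=> xy; rewrite contract_contract_edges /collapsed_tree; congr contract_edges.
apply/funext => e; case: (eqVneq (y e) 0) => //= /xy ->.
by rewrite eqxx.
Qed.

Lemma reorder_act1 x : reorder_act 1%g x = x.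
Proof. by apply/ffunP => e; rewrite ffunE invg1 perm1. Qed.

Lemma reorder_actM (g h : {perm edge t}) x :
  reorder_act (g * h)%g x = reorder_act h (reorder_act g x).
Proof. by apply/ffunP => e; rewrite !ffunE invMg permM. Qed.

Lemma reorder_act_supp (g : {perm edge t}) x y :
  supp_le x y -> supp_le (reorder_act g x) (reorder_act g y).
Proof. by move=> xy e; rewrite !ffunE => /xy. Qed.

(** The surviving edges of [x] and [y] are matched in depth-first order and the matching is extended
    to all edges. In general [g] does not respect the structure of [t]. *)
Lemma collapsed_tree_perm x y : collapsed_tree x = collapsed_tree y ->
  exists g : {perm edge t}, y = reorder_act g x /\
    forall z, supp_le z x -> collapsed_tree z = collapsed_tree (reorder_act g z).
Proof.
pose lab u := contract_edges (fun e => if (u : X) e == 0 then None else Some e).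
have labP u : uniq (labels (lab u)) /\ forall e, (e \in labels (lab u)) = (u e != 0).
  have [|uu m] := @labels_contract_edges _ _ (fun e => if u e == 0 then None else Some e).
    by move=> e e' a; case: ifP => // _ [->]; case: ifP => // _ [].
  split=> // e; apply/idP/idP => [/m[e']|ue]; first by case: ifPn => // ue [<-].
  by apply/m; exists e; rewrite (negbTE ue).
have labE u : collapsed_tree u = contract_tree (Some \o u) (lab u).
  rewrite contract_contract_edges /collapsed_tree; congr contract_edges.
  by apply/funext => e; case: (u e == 0).
rewrite !labE => /contract_tree_shape [xy shape].
have [ux mx] := labP x; have [uy my] := labP y.
have szxy : size (labels (lab x)) = size (labels (lab y)).
  by have := congr1 size xy; rewrite !size_map.
have [g gxy] := perm_map_seq ux uy szxy.
have gy : y = reorder_act g x.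
  apply/ffunP => e; rewrite ffunE.
  have [] := boolP (y e == 0) => ye.
    (* If [g^-1 e] survived in [x], its image [e] would survive in [y]. *)
    rewrite (eqP ye); apply/esym/eqP; apply: contraTT ye; rewrite -mx => ge.
    by rewrite -my -gxy; apply/mapP; exists (g^-1 e)%g => //; rewrite permKV.
  rewrite -my -gxy in ye; case/mapP: ye => e' e'x ->; rewrite permK.
  have ilt : (index e' (labels (lab x)) < size (labels (lab x)))%N by rewrite index_mem.
  have := congr1 (fun s => nth 0 s (index e' (labels (lab x)))) xy.
  by rewrite (nth_map e') // (nth_map e') -?szxy // -gxy (nth_map e') // nth_index.
exists g; split=> // z zx; rewrite (collapsed_treeE zx).
rewrite (@collapsed_treeE (reorder_act g z) y); last by rewrite gy; exact: reorder_act_supp.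
apply: shape; rewrite -gxy -map_comp; apply: eq_map => e /=.
by rewrite ffunE permK.
Qed.

Definition unordered_equiv x y : Prop :=
  @reordering_equiv R n d t (\pi_{eq_quot shape_equiv} x) (\pi_{eq_quot shape_equiv} y).

Lemma shape_piP x y :
  (\pi_{eq_quot shape_equiv} x = \pi_{eq_quot shape_equiv} y :> Defs.shape R n d t) <->
  collapsed_tree x = collapsed_tree y.
Proof.
split=> [/eqmodP/asboolP//|xy]; apply/eqmodP; exact/asboolP.
Qed.

Lemma unordered_equiv_sym x y : unordered_equiv x y -> unordered_equiv y x.
Proof. by rewrite /unordered_equiv generic_quotient.equiv_sym. Qed.

Lemma unordered_equiv_trans y x z :
  unordered_equiv x y -> unordered_equiv y z -> unordered_equiv x z.
Proof. exact: generic_quotient.equiv_trans. Qed.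

(* An equivalence is carried by a permutation of the edges that is an
   equivalence on every tree obtained by contracting further edges: this is
   what allows whole neighbourhoods to be transported along it. *)
Lemma unordered_equiv_perm x y : unordered_equiv x y ->
  exists g : {perm edge t}, y = reorder_act g x /\
    forall z, supp_le z x -> unordered_equiv z (reorder_act g z).
Proof.
pose good x y := exists g : {perm edge t}, y = reorder_act g x /\
    forall z, supp_le z x -> unordered_equiv z (reorder_act g z).
have good_trans y' x' z' : good x' y' -> good y' z' -> good x' z'.
  move=> [g [-> gP]] [h [-> hP]]; exists (g * h)%g; rewrite reorder_actM; split=> // z zx.
  rewrite reorder_actM; apply: unordered_equiv_trans (gP _ zx) (hP _ _).
  exact: reorder_act_supp.
have good_eq x' y' : collapsed_tree x' = collapsed_tree y' -> good x' y'.
  move=> /collapsed_tree_perm[g [-> gP]]; exists g; split=> // z /gP /shape_piP zz.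
  by rewrite /unordered_equiv zz; exact: generic_quotient.equiv_refl.
have good_sym x' y' : good x' y' -> good y' x'.
  move=> [g [-> gP]]; exists (g^-1)%g; rewrite -reorder_actM mulgV reorder_act1; split=> // z zx.
  apply/unordered_equiv_sym.
  rewrite -{2}[z](reorder_act1 z) -(mulVg g) reorder_actM; apply: gP.
  by rewrite -[x'](reorder_act1 x') -(mulgV g) reorder_actM; exact: reorder_act_supp.
move=> /asboolP xy; rewrite -/(good x y).
(* The closure relates shapes, so the induction hypothesis must cover all preshapes representing its
   two ends. *)
suff H a b : clos_refl_sym_trans (Defs.shape R n d t)
    (fun a b : Defs.shape R n d t => exists (x : X) (g : {perm edge t}),
    [/\ g \in reorderings t, a = \pi_{eq_quot shape_equiv} x
      & b = \pi_{eq_quot shape_equiv} (reorder_act g x)]) a b ->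
    forall x y, a = \pi_{eq_quot shape_equiv} x -> b = \pi_{eq_quot shape_equiv} y -> good x y.
  exact: H xy _ _ erefl erefl.
move=> {xy}; elim=> {a b}.
- move=> a b [x0 [g [gt -> ->]]] u v /shape_piP xx /shape_piP yy.
  apply: (good_trans x0); first exact: good_eq.
  apply: (good_trans (reorder_act g x0)); last exact: good_eq.
  exists g; split=> // z _; apply/asboolP; apply: rst_step.
  by exists z, g.
- by move=> a u v -> /shape_piP/good_eq.
- by move=> a b _ IH u v au bv; apply: good_sym; exact: IH.
- move=> a b c _ IH1 _ IH2 u v au cv.
  apply: (good_trans (repr b)); [exact: IH1 (esym (reprK b))|exact: IH2 (esym (reprK b)) cv].
Qed.

End ShapeEquivalence.

(** * Norms *)

Section EuclideanNorm.
Context {R : realType} {I : finType}.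
Implicit Types f g : I -> R.

Definition l2norm f : R := Num.sqrt (\sum_i f i ^+ 2).

Lemma l2norm_ge0 f : 0 <= l2norm f.
Proof. exact: sqrtr_ge0. Qed.

Lemma l2norm_sqr f : l2norm f ^+ 2 = \sum_i f i ^+ 2.
Proof. by rewrite sqr_sqrtr // sumr_ge0 // => i _; exact: sqr_ge0. Qed.

Lemma l2norm_ger f i : `|f i| <= l2norm f.
Proof.
rewrite -sqrtr_sqr ler_wsqrtr // (bigD1 i) //= lerDl sumr_ge0 // => j _.
exact: sqr_ge0.
Qed.

(** Cauchy-Schwarz: for nonzero norms, expand the nonnegative sum of the squares of
    [l2norm g * f i - l2norm f * g i]. *)
Lemma l2norm_dot f g : \sum_i f i * g i <= l2norm f * l2norm g.
Proof.
have [f0|fN0] := eqVneq (l2norm f) 0.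
  rewrite f0 mul0r big1 // => i _.
  by have := l2norm_ger f i; rewrite f0 normr_le0 => /eqP ->; rewrite mul0r.
have [g0|gN0] := eqVneq (l2norm g) 0.
  rewrite g0 mulr0 big1 // => i _.
  by have := l2norm_ger g i; rewrite g0 normr_le0 => /eqP ->; rewrite mulr0.
have AB0 : 0 < l2norm f * l2norm g by rewrite mulr_gt0 // lt_def ?fN0 ?gN0 l2norm_ge0.
rewrite -subr_ge0 -(pmulr_rge0 _ AB0).
suff -> : l2norm f * l2norm g * (l2norm f * l2norm g - \sum_i f i * g i)
    = 2^-1 * \sum_i (l2norm g * f i - l2norm f * g i) ^+ 2.
  by rewrite mulr_ge0 ?invr_ge0 // sumr_ge0 // => i _; exact: sqr_ge0.
have -> : \sum_i (l2norm g * f i - l2norm f * g i) ^+ 2 =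
    \sum_i (l2norm g ^+ 2 * f i ^+ 2 + l2norm f ^+ 2 * g i ^+ 2
      - 2 * (l2norm f * l2norm g) * (f i * g i)).
  by apply: eq_bigr => i _; ring.
rewrite sumrB big_split /= -!mulr_sumr -!l2norm_sqr.
by field.
Qed.

Lemma l2norm_triangle f g : l2norm (fun i => f i + g i) <= l2norm f + l2norm g.
Proof.
rewrite -(@ler_pXn2r _ 2) ?nnegrE ?addr_ge0 ?l2norm_ge0 // sqrrD !l2norm_sqr.
under eq_bigr do rewrite sqrrD.
by rewrite !big_split /= lerD2r lerD2l -mulr2n lerMn2r l2norm_dot.
Qed.

Lemma l2normZ c f : l2norm (fun i => c * f i) = `|c| * l2norm f.
Proof.
rewrite /l2norm; under eq_bigr do rewrite exprMn.
by rewrite -mulr_sumr sqrtrM ?sqr_ge0 // sqrtr_sqr.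
Qed.

Lemma ler_l2norm f g : (forall i, 0 <= f i <= g i) -> l2norm f <= l2norm g.
Proof.
move=> fg; rewrite ler_wsqrtr // ler_sum // => i _.
by have /andP[f0 fgi] := fg i; rewrite ler_sqr // nnegrE // (le_trans f0).
Qed.

Lemma l2norm_ler f : l2norm f <= \sum_i `|f i|.
Proof.
have s0 (P : pred I) : 0 <= \sum_(i | P i) `|f i| by apply: sumr_ge0.
rewrite -(@ler_pXn2r _ 2) ?nnegrE ?l2norm_ge0 //.
rewrite l2norm_sqr expr2 mulr_suml ler_sum // => i _.
rewrite -real_normK ?num_real // expr2 ler_wpM2l //.
by rewrite (bigD1 i) //= lerDl.
Qed.

End EuclideanNorm.

Section PreshapeNorms.
Context {R : realType} {n d : nat} {t : btree}.
Local Notation X := {ffun edge t -> 'M[R]_(n, d)}.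

(** The common properties through which both metrics are treated at once. Invariance is asked under
    all permutations of edges, since those carrying an equivalence may fail to be tree
    automorphisms; the last two fields compare [N] with the coordinates. *)
Record preshape_norm (N : X -> R) : Prop := PreshapeNorm {
  pnormD : forall x y : X, N (x + y) <= N x + N y;
  pnormZ : forall c (x : X), N (c *: x) = `|c| * N x;
  pnorm_reorder : forall (g : {perm edge t}) x, N (reorder_act g x) = N x;
  pnorm_ge_coord : forall (x : X) e i j, `|x e i j| <= N x;
  pnorm_le_sum : forall x : X, N x <= \sum_(p : edge t * ('I_n * 'I_d)) `|x p.1 p.2.1 p.2.2| }.

Lemma euclidean_normE (a : 'M[R]_(n, d)) :
  euclidean_norm a = l2norm (fun p : 'I_n * 'I_d => a p.1 p.2).
Proof. by rewrite /euclidean_norm pair_big. Qed.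

Lemma sum_reorder (F : 'M[R]_(n, d) -> R) (g : {perm edge t}) (x : X) :
  \sum_e F (reorder_act g x e) = \sum_e F (x e).
Proof.
rewrite [RHS](reindex_inj (@perm_inj _ g^-1%g)).
by apply: eq_bigr => e _; rewrite ffunE.
Qed.

Lemma euclidean_normD (a b : 'M[R]_(n, d)) :
  euclidean_norm (a + b) <= euclidean_norm a + euclidean_norm b.
Proof.
rewrite !euclidean_normE; apply: le_trans (l2norm_triangle _ _).
by rewrite le_eqVlt; apply/orP; left; apply/eqP; congr l2norm; apply/funext => p; rewrite mxE.
Qed.

Lemma euclidean_normZ c (a : 'M[R]_(n, d)) :
  euclidean_norm (c *: a) = `|c| * euclidean_norm a.
Proof.
by rewrite !euclidean_normE -l2normZ; congr l2norm; apply/funext => p; rewrite mxE.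
Qed.

Lemma euclidean_norm_ge0 (a : 'M[R]_(n, d)) : 0 <= euclidean_norm a.
Proof. exact: sqrtr_ge0. Qed.

Lemma euclidean_norm_coord (a : 'M[R]_(n, d)) i j : `|a i j| <= euclidean_norm a.
Proof. by rewrite euclidean_normE (l2norm_ger (fun p : 'I_n * 'I_d => a p.1 p.2) (i, j)). Qed.

Lemma sum_euclidean_norm_le (x : X) : \sum_e euclidean_norm (x e) <=
  \sum_(p : edge t * ('I_n * 'I_d)) `|x p.1 p.2.1 p.2.2|.
Proof.
rewrite -(pair_bigA _ (fun e q => `|x e q.1 q.2|)) ler_sum // => e _.
by rewrite euclidean_normE l2norm_ler.
Qed.

Lemma d1_norm : preshape_norm (fun x : X => d1 x 0).
Proof.
have d10 (x : X) : d1 x 0 = \sum_e euclidean_norm (x e).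
  by apply: eq_bigr => e _; rewrite ffunE subr0.
split.
- move=> x y; rewrite !d10 -big_split ler_sum // => e _.
  by rewrite ffunE euclidean_normD.
- move=> c x; rewrite !d10 mulr_sumr; apply: eq_bigr => e _.
  by rewrite ffunE euclidean_normZ.
- by move=> g x; rewrite !d10 sum_reorder.
- move=> x e i j; rewrite d10 (bigD1 e) //= (le_trans (euclidean_norm_coord _ i j)) // lerDl.
  by rewrite sumr_ge0 // => e' _; exact: euclidean_norm_ge0.
- by move=> x; rewrite d10 sum_euclidean_norm_le.
Qed.

Lemma d2_norm : preshape_norm (fun x : X => d2 x 0).
Proof.
have d20 (x : X) : d2 x 0 = l2norm (fun e => euclidean_norm (x e)).
  by rewrite /d2 /l2norm; congr Num.sqrt; apply: eq_bigr => e _; rewrite ffunE subr0.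
split.
- move=> x y; rewrite !d20; apply: le_trans (l2norm_triangle _ _).
  by apply: ler_l2norm => e; rewrite ffunE euclidean_norm_ge0 euclidean_normD.
- move=> c x; rewrite !d20 -[`|c| in RHS]normr_id -l2normZ; congr l2norm; apply/funext => e.
  by rewrite ffunE euclidean_normZ.
- by move=> g x; rewrite !d20 /l2norm (sum_reorder (fun a => euclidean_norm a ^+ 2)).
- move=> x e i j; rewrite d20 (le_trans (euclidean_norm_coord _ i j)) //.
  by have := l2norm_ger (fun e => euclidean_norm (x e)) e; rewrite ger0_norm ?euclidean_norm_ge0.
- move=> x; rewrite d20; apply: le_trans (sum_euclidean_norm_le x).
  apply: le_trans (l2norm_ler _) _.
  by apply: ler_sum => e _; rewrite ger0_norm ?euclidean_norm_ge0.
Qed.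

Lemma preshape_normP (dist : X -> X -> R) : dist = d1 \/ dist = d2 ->
  exists2 N, preshape_norm N & dist = fun x y => N (x - y).
Proof.
case=> ->;
  [exists (fun x => d1 x 0); [exact: d1_norm|]|exists (fun x => d2 x 0); [exact: d2_norm|]];
  apply/funext => x; apply/funext => y.
  by apply: eq_bigr => e _; rewrite !ffunE subr0.
by rewrite /d2; congr Num.sqrt; apply: eq_bigr => e _; rewrite !ffunE subr0.
Qed.

End PreshapeNorms.

(** * Chains, quotient metrics and paths *)

Section Chains.
Context {R : realType} {Q : Type}.
Implicit Types link : Q -> Q -> R -> Prop.

(** The links used below relate points of a quotient, so the identifications inside a chain become
    shared endpoints. *)
Inductive chain link : Q -> Q -> R -> Prop :=
| chain_link a b s : link a b s -> chain link a b s
| chain_rcons a b c s s' : chain link a b s -> link b c s' -> chain link a c (s + s').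

Lemma chain_cat link a b c s s' :
  chain link a b s -> chain link b c s' -> chain link a c (s + s').
Proof.
move=> ab bc; elim: bc a s ab => {b c s'} [b c s' bc a s ab|b c e s' s'' _ IH ce a s ab].
  exact: chain_rcons ab bc.
by rewrite addrA; apply: chain_rcons ce; exact: IH.
Qed.

Lemma chain_rev link : (forall a b s, link a b s -> link b a s) ->
  forall a b s, chain link a b s -> chain link b a s.
Proof.
move=> linkC a b s; elim=> {a b s} [a b s /linkC|a b c s s' _ IH /linkC bc].
  exact: chain_link.
by rewrite addrC; apply: chain_cat IH; exact: chain_link.
Qed.

(** [D] may be signed: it will be a difference of norms as well as a distance. *)
Lemma chain_bound link (D : Q -> Q -> R) :
  (forall b a c, D a c <= D a b + D b c) ->
  (forall a b s, link a b s -> D a b <= s) ->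
  forall a b s, chain link a b s -> D a b <= s.
Proof.
move=> DT linkD a b s; elim=> {a b s} [a b s|a b c s s' _ ab /linkD bc]; first exact: linkD.
exact: le_trans (DT b a c) (lerD ab bc).
Qed.

End Chains.

Section QuotientDist.
Context {R : realType} {T : choiceType} (e : equiv_rel T) (rho : T -> T -> R).
Hypothesis rho_ge0 : forall x y, 0 <= rho x y.
Local Notation Q := {eq_quot e}.

Definition quotient_link (a b : Q) (s : R) : Prop :=
  exists x y, [/\ \pi x = a, \pi y = b & s = rho x y].

Lemma quotient_chainP (a b : Q) (s : R) :
  (exists (k : nat) (x y : nat -> T),
    [/\ \pi_{eq_quot e} (x 0%N) = a,
        forall i, (i < k)%N -> e (y i) (x i.+1),
        \pi_{eq_quot e} (y k) = b
      & s = \sum_(0 <= i < k.+1) rho (x i) (y i)]) <-> chain quotient_link a b s.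
Proof.
split=> [[k [x [y [<- exy <- ->]]]]|].
  elim: k exy => [|k IH] exy.
    by rewrite big_nat1; apply: chain_link; exists (x 0%N), (y 0%N).
  rewrite big_nat_recr //=; apply: chain_rcons; first by apply: IH => i ik; exact/exy/ltnW.
  by exists (x k.+1), (y k.+1); split=> //; apply/esym/eqmodP; exact: exy.
elim=> {a b s} [a b s [x [y [xa yb ->]]]|a b c s s' _ [k [x [y [xa exy yb ->]]]]
    [x' [y' [xb yc ->]]]].
  by exists 0%N, (fun=> x), (fun=> y); split=> //; rewrite big_nat1.
(* The old links have indices [0] to [k]; the new link has index [k.+1]. *)
exists k.+1, (fun i => if (i <= k)%N then x i else x'), (fun i => if (i <= k)%N then y i else y').
split; rewrite ?ltnn //.
  move=> i; rewrite ltnS => ik; rewrite ik; case: ltnP => [/exy//|ki].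
  have -> : i = k by apply/eqP; rewrite eqn_leq ik.
  by apply/eqmodP; rewrite yb xb.
rewrite [in RHS]big_nat_recr //= ltnn; congr (_ + _).
by apply: eq_big_nat => i /andP[_]; rewrite ltnS => ->.
Qed.

Lemma quotient_chain_ge0 (a b : Q) s : chain quotient_link a b s -> 0 <= s.
Proof.
elim=> {a b s} [a b s [x [y [_ _ ->]]]|a b c s s' _ s0 [x [y [_ _ ->]]]] //.
exact: addr_ge0.
Qed.

Let chains (a b : Q) := [set s | exists (k : nat) (x y : nat -> T),
    [/\ \pi_{eq_quot e} (x 0%N) = a,
        forall i, (i < k)%N -> e (y i) (x i.+1),
        \pi_{eq_quot e} (y k) = b
      & s = \sum_(0 <= i < k.+1) rho (x i) (y i)]].

Let chains_inf a b : has_inf (chains a b).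
Proof.
split; last by exists 0 => s /quotient_chainP/quotient_chain_ge0.
exists (rho (repr a) (repr b)); apply/quotient_chainP/chain_link.
by exists (repr a), (repr b); rewrite !reprK.
Qed.

Lemma quotient_dist_le (a b : Q) s : chain quotient_link a b s -> quotient_dist rho a b <= s.
Proof. by move=> /quotient_chainP ab; apply: ge_inf => //; have [] := chains_inf a b. Qed.

Lemma quotient_dist_pi x y : quotient_dist rho (\pi_{eq_quot e} x) (\pi_{eq_quot e} y) <= rho x y.
Proof. by apply: quotient_dist_le; apply: chain_link; exists x, y. Qed.

Lemma quotient_dist_ge0 (a b : Q) : 0 <= quotient_dist rho a b.
Proof.
apply: lb_le_inf; first by have [] := chains_inf a b.
by move=> s /quotient_chainP/quotient_chain_ge0.
Qed.

Lemma quotient_dist_chain (a b : Q) eta : 0 < eta ->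
  exists2 s, chain quotient_link a b s & s <= quotient_dist rho a b + eta.
Proof.
move=> eta0; have [s /quotient_chainP ab /ltW se] := inf_adherent eta0 (chains_inf a b).
by exists s.
Qed.

Lemma quotient_dist_triangle (b a c : Q) :
  quotient_dist rho a c <= quotient_dist rho a b + quotient_dist rho b c.
Proof.
apply/ler_addgt0Pr => eta eta0.
have [s ab sab] := quotient_dist_chain a b (divr_gt0 eta0 (ltr0n R 2)).
have [s' bc sbc] := quotient_dist_chain b c (divr_gt0 eta0 (ltr0n R 2)).
by have := quotient_dist_le (chain_cat ab bc); lra.
Qed.

(** [f] maps the current space to the final quotient, so chains of one fixed kind there can
    approximate the distance at each level of an iterated quotient. *)
Definition approximated_by (A B : Type) (link : B -> B -> R -> Prop) (f : A -> B)
    (D : A -> A -> R) : Prop :=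
  forall a b eta, 0 < eta -> exists2 s, chain link (f a) (f b) s & s <= D a b + eta.

(** Each link of a nearly minimal chain is replaced by a chain approximating [rho]. The error is
    halved at every step of the induction, so the number of links never enters. *)
Lemma quotient_dist_approx (B : Type) (link : B -> B -> R -> Prop) (f : Q -> B) :
  approximated_by link (fun x => f (\pi_{eq_quot e} x)) rho ->
  approximated_by link f (quotient_dist rho).
Proof.
move=> happ a b eta eta0; have eta2 : 0 < eta / 2 by rewrite divr_gt0.
have [s ab sab] := quotient_dist_chain a b eta2.
suff /(_ _ eta2)[s' ab' ss'] : forall et, 0 < et ->
    exists2 s', chain link (f a) (f b) s' & s' <= s + et.
  by exists s' => //; lra.
elim: ab {sab} => {a b s} [a b s [x [y [<- <- ->]]]|a b c s s' _ IH [x [y [xb <- ->]]]] et et0.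
  exact: happ.
rewrite -{b}xb in IH.
have et2 : 0 < et / 2 by rewrite divr_gt0.
have [s1 ab s1s] := IH _ et2; have [s2 bc s2s] := happ x y _ et2.
by exists (s1 + s2); [exact: chain_cat ab bc|lra].
Qed.

End QuotientDist.

(** * Lipschitz paths and their lengths *)

Section LipschitzPaths.
Context {R : realType} {T : Type} (rho : T -> T -> R).

(** Running over the interval from 0 to [l] with Lipschitz constant 1 makes the lengths add under
    concatenation. *)
Definition unit_speed_joined (a b : T) (l : R) : Prop :=
  0 <= l /\ exists gamma : R -> T, [/\ gamma 0 = a, gamma l = b
    & forall s u : R, 0 <= s -> s <= u -> u <= l -> rho (gamma s) (gamma u) <= u - s].

Lemma unit_speed_joined_trans b a c l m : (forall y x z, rho x z <= rho x y + rho y z) ->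
  unit_speed_joined a b l -> unit_speed_joined b c m -> unit_speed_joined a c (l + m).
Proof.
move=> rhoT [l0 [f [f0 fl fL]]] [m0 [g [g0 gm gL]]]; split; first exact: addr_ge0.
exists (fun s => if s <= l then f s else g (s - l)); split.
- by rewrite l0.
- case: leP => lm; last by rewrite addrC addKr.
  (* Here [m = 0], so [b] and [c] coincide. *)
  have -> : l + m = l by lra.
  by rewrite fl -g0 -gm; congr g; lra.
- move=> s u s0 su ul; case: (leP u l) => ul'.
    by rewrite (le_trans su ul'); exact: fL.
  case: (leP s l) => sl; last first.
    have : rho (g (s - l)) (g (u - l)) <= u - l - (s - l) by apply: gL; lra.
    by move=> /le_trans; apply; lra.
  apply: le_trans (rhoT b _ _) _.
  have := fL s l s0 sl (lexx _); rewrite fl.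
  have : rho (g 0) (g (u - l)) <= u - l - 0 by apply: gL; lra.
  by rewrite g0; lra.
Qed.

Lemma unit_speed_joined_rescale a b l : unit_speed_joined a b l ->
  exists gamma : R -> T, [/\ gamma 0 = a, gamma 1 = b
    & forall s u : R, 0 <= s -> s <= u -> u <= 1 -> rho (gamma s) (gamma u) <= l * (u - s)].
Proof.
move=> [l0 [f [f0 fl fL]]]; exists (fun s => f (l * s)); split.
- by rewrite mulr0.
- by rewrite mulr1.
- move=> s u s0 su u1; rewrite mulrBr; apply: fL.
  + exact: mulr_ge0.
  + exact: ler_wpM2l.
  + by rewrite ler_piMr.
Qed.

Lemma lipschitz_is_path a b l (gamma : R -> T) :
  (forall x y, 0 <= rho x y) -> (forall x y, rho x y = rho y x) ->
  gamma 0 = a -> gamma 1 = b ->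
  (forall s u : R, 0 <= s -> s <= u -> u <= 1 -> rho (gamma s) (gamma u) <= l * (u - s)) ->
  is_path rho a b gamma.
Proof.
move=> rho0 rhoC g0 g1 gL; split=> // u /[!in_itv]/= /andP[u0 u1].
have gLn s : 0 <= s -> s <= 1 -> rho (gamma s) (gamma u) <= `|l| * `|u - s|.
  move=> s0 s1; have [su|us] := leP s u.
    apply: le_trans (gL _ _ s0 su u1) _; rewrite -normrM; exact: ler_norm.
  rewrite rhoC distrC; apply: le_trans (gL _ _ u0 (ltW us) s1) _.
  by rewrite -normrM; exact: ler_norm.
apply/cvgrPdist_le => /= eps eps0.
(* The added 1 keeps the denominator positive when [l = 0]. *)
have l1 : 0 < `|l| + 1 by rewrite ltr_wpDl.
rewrite near_withinE; near=> s => sI.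
have /andP[s0 s1] : 0 <= s <= 1 by move: sI; rewrite /= in_itv.
rewrite sub0r normrN ger0_norm //; apply: le_trans (gLn _ s0 s1) _.
have : `|u - s| <= eps / (`|l| + 1).
  by near: s; apply: cvgr_dist_le; [exact: cvg_id|rewrite divr_gt0].
rewrite ler_pdivlMr // mulrC; apply: le_trans; rewrite ler_wpM2r //; lra.
Unshelve. all: by end_near. Qed.

Lemma lipschitz_path_length l (gamma : R -> T) :
  (forall s u : R, 0 <= s -> s <= u -> u <= 1 -> rho (gamma s) (gamma u) <= l * (u - s)) ->
  (path_length rho gamma <= l%:E)%E.
Proof.
move=> gL; apply: ge_ereal_sup => _ [s part <-]; rewrite lee_fin.
have [sorted_s last_s] := part.
have nthS i : (i < size s)%N -> nth 1 (0 :: s) i <= nth 1 (0 :: s) i.+1.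
  by move=> si; apply/ltW/(pathP 1 sorted_s).
apply: (@le_trans _ _ (\sum_(0 <= i < size s) l * (nth 1 (0 :: s) i.+1 - nth 1 (0 :: s) i))).
  rewrite big_nat [leRHS]big_nat ler_sum // => i /andP[_ si]; apply: gL.
  - by apply: itv_partition_nth_ge part; rewrite ltnS ltnW.
  - exact: nthS.
  - exact: itv_partition_nth_le part.
rewrite -mulr_sumr telescope_sumr // (itv_partition_nth_size _ part) /=.
by rewrite subr0 mulr1.
Qed.

Lemma path_length_ge (gamma : R -> T) : ((rho (gamma 0) (gamma 1))%:E <= path_length rho gamma)%E.
Proof.
apply: ereal_sup_ubound; exists [:: 1]; last by rewrite /= big_nat1.
by apply: itv_partition1; exact: ltr01.
Qed.

End LipschitzPaths.

(** * Restricted preshapes and segment metrics *)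

(** [eps] is the least nonzero absolute value of [F], capped at 1. *)
Lemma finite_gap (R : realType) (I : finType) (F : I -> R) :
  exists2 eps : R, 0 < eps & forall i, `|F i| < eps -> F i = 0.
Proof.
exists (\big[Num.min/1]_(i | F i != 0) `|F i|).
  by apply: (big_ind (fun y => 0 < y)) => [|x y x0 y0|i]; rewrite ?ltr01 ?lt_min ?x0 ?normr_gt0.
move=> i; apply: contraTeq => Fi; rewrite -leNgt.
exact: (bigmin_le_cond _ (fun i => `|F i|)).
Qed.

Section LinkedPreshapes.
Context {R : realType} {n d : nat} {t : btree}.
Local Notation X := {ffun edge t -> 'M[R]_(n, d)}.
Variables (EE : {set {set edge t}}) (N : X -> R).
Hypothesis NP : preshape_norm N.
Implicit Types x y z : X.

(** Both preshapes lie in one coordinate subspace of the restricted preshape space, hence so does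
    the segment between them; [linked x x] is membership in that space. *)
Definition linked x y : Prop :=
  exists2 E1 : {set edge t}, E1 \in EE & forall e, e \notin E1 -> x e = 0 /\ y e = 0.

Lemma linked_sym x y : linked x y -> linked y x.
Proof. by move=> [E1 E1E xy]; exists E1 => // e /xy[]. Qed.

Lemma linked_sub x y x' y' : linked x y ->
  (forall e, x e = 0 -> y e = 0 -> x' e = 0 /\ y' e = 0) -> linked x' y'.
Proof. by move=> [E1 E1E xy] sub; exists E1 => // e /xy[]; exact: sub. Qed.

Lemma linkedl x y : linked x y -> linked x x.
Proof. by move=> /linked_sub; apply. Qed.

Lemma linkedr x y : linked x y -> linked y y.
Proof. by move=> /linked_sym/linkedl. Qed.

Lemma linked_supp x y : supp_le x y -> linked y y -> linked x y.
Proof. by move=> xy /linked_sub; apply => e y0 _; split=> //; exact: xy. Qed.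

Lemma in_restrictedP x : reflect (linked x x) (in_restricted EE x).
Proof.
apply: (iffP existsP) => [[E1 /andP[E1E /forallP x0]]|[E1 E1E x0]]; exists E1 => //.
  by move=> e eE1; have /implyP/(_ eE1)/eqP := x0 e.
by rewrite E1E; apply/forallP => e; apply/implyP => /x0[->].
Qed.

Lemma pnorm0 : N 0 = 0.
Proof. by rewrite -(scale0r 0) (pnormZ NP) normr0 mul0r. Qed.

Lemma pnormN x : N (- x) = N x.
Proof. by rewrite -scaleN1r (pnormZ NP) normrN1 mul1r. Qed.

Lemma pnormB x y : N (x - y) = N (y - x).
Proof. by rewrite -pnormN opprB. Qed.

Lemma pnorm_ge0 x : 0 <= N x.
Proof.
have := pnormD NP x (- x); rewrite subrr pnorm0 pnormN; lra.
Qed.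

Lemma pnorm_eq0 x : N x = 0 -> x = 0.
Proof.
move=> x0; apply/ffunP => e; apply/matrixP => i j; rewrite ffunE mxE.
by apply/eqP; rewrite -normr_le0 -x0; exact: pnorm_ge_coord.
Qed.

Lemma pnorm_triangle y x z : N (x - z) <= N (x - y) + N (y - z).
Proof. by apply: le_trans (pnormD NP _ _); rewrite addrA subrK. Qed.

Lemma reorder_actB (g : {perm edge t}) x y :
  reorder_act g x - reorder_act g y = reorder_act g (x - y).
Proof. by apply/ffunP => e; rewrite !ffunE. Qed.

Lemma reorder_actZ (g : {perm edge t}) c x :
  reorder_act g (c *: x) = c *: reorder_act g x.
Proof. by apply/ffunP => e; rewrite !ffunE. Qed.

Lemma supp_leZ c x : supp_le (c *: x) x.
Proof. by move=> e x0; rewrite ffunE x0 scaler0. Qed.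

Definition gapped (eps : R) x : Prop := forall e i j, `|x e i j| < eps -> x e i j = 0.

Lemma gapped_reorder eps g x : gapped eps x -> gapped eps (reorder_act g x).
Proof. by move=> gx e i j; rewrite ffunE; exact: gx. Qed.

(** A change smaller than the gap cannot bring a nonzero entry of [x] to 0. *)
Lemma gapped_supp eps x y : gapped eps x -> N (x - y) < eps -> supp_le x y.
Proof.
move=> gx xy e y0; apply/matrixP => i j; rewrite mxE; apply: gx.
apply: le_lt_trans xy.
have -> : x e i j = (x - y) e i j by rewrite !ffunE y0 subr0.
exact: pnorm_ge_coord.
Qed.

Lemma gapped_ex x : exists2 eps, 0 < eps & gapped eps x.
Proof.
have [eps eps0 epsP] := finite_gap (fun p : edge t * ('I_n * 'I_d) => x p.1 p.2.1 p.2.2).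
by exists eps => // e i j; exact: (epsP (e, (i, j))).
Qed.

End LinkedPreshapes.

(** * Metrics generated by segments, and separation of points *)

Section QuotientGeometry.
Context {R : realType} {n d : nat} {t : btree} {Q : choiceType}.
Local Notation X := {ffun edge t -> 'M[R]_(n, d)}.
Variables (EE : {set {set edge t}}) (N : X -> R) (P : X -> Q) (D : Q -> Q -> R).
Local Notation linked := (linked EE).

Definition segment_link (a b : Q) (s : R) : Prop :=
  exists x y, [/\ linked x y, P x = a, P y = b & s = N (x - y)].

(* [D] is the largest pseudometric on the quotient [Q] of the restricted
   preshapes that is bounded by the norm along segments between restricted
   preshapes. *)
Record segment_metric : Prop := SegmentMetric {
  sm_norm : preshape_norm N;
  sm_nonempty : EE != finset.set0;
  sm_surj : forall a, exists2 x, linked x x & P x = a;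
  sm_kernel : forall x y, linked x x -> linked y y -> P x = P y <-> unordered_equiv x y;
  sm_triangle : forall b a c, D a c <= D a b + D b c;
  sm_segment : forall x y, linked x y -> D (P x) (P y) <= N (x - y);
  sm_approx : approximated_by segment_link id D }.

Hypothesis H : segment_metric.
Let NP := sm_norm H.
Implicit Types (x y z : X) (a b c : Q).

Lemma transport x u v : linked u u -> linked v v -> P u = P v -> supp_le x u ->
  exists g : {perm edge t}, [/\ unordered_equiv x (reorder_act g x),
    N (reorder_act g x - v) = N (x - u) & v = reorder_act g u].
Proof.
move=> uu vv /(sm_kernel H uu vv)/unordered_equiv_perm[g [-> gP]] xu.
by exists g; split; [exact: gP|rewrite reorder_actB (pnorm_reorder NP)|].
Qed.

Lemma segment_metric_le a b s : chain segment_link a b s -> D a b <= s.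
Proof.
apply: chain_bound; first exact: (sm_triangle H).
by move=> {}a {}b {}s [x [y [xy <- <- ->]]]; exact: sm_segment.
Qed.

Lemma segment_chain_ge0 a b s : chain segment_link a b s -> 0 <= s.
Proof.
elim=> {a b s} [a b s [x [y [_ _ _ ->]]]|a b c s s' _ s0 [x [y [_ _ _ ->]]]].
  exact: pnorm_ge0.
by rewrite addr_ge0 // pnorm_ge0.
Qed.

Lemma segment_metric_ge0 a b : 0 <= D a b.
Proof.
apply/ler_addgt0Pr => eta /(sm_approx H a b)[s /segment_chain_ge0]; exact: le_trans.
Qed.

Lemma segment_metric_sym a b : D a b = D b a.
Proof.
suff le a' b' : D a' b' <= D b' a' by apply/eqP; rewrite eq_le !le.
apply/ler_addgt0Pr => eta /(sm_approx H b' a')[s ba]; apply: le_trans.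
apply: segment_metric_le; apply: chain_rev ba => {}a {}b {}s [x [y [xy xa yb ->]]].
by exists y, x; split=> //; [exact: linked_sym|exact: pnormB].
Qed.

Lemma segment_metric_xx a : D a a = 0.
Proof.
apply/eqP; rewrite eq_le segment_metric_ge0 andbT.
have [x xx <-] := sm_surj H a; apply: le_trans (sm_segment H xx) _.
by rewrite subrr pnorm0.
Qed.

(* A chain shorter than the gap of [x] never collapses an edge of [x], so its
   identifications can be applied to [x] along the way. *)
Lemma short_chain_lift a b s x y eps : chain segment_link a b s ->
  linked x x -> P x = a -> gapped eps x -> s < eps -> linked y y -> P y = b ->
  exists g : {perm edge t}, unordered_equiv x (reorder_act g x) /\
    N (reorder_act g x - y) <= s.
Proof.
move=> ab xx xa gx; elim: ab xa y => {a b s} [a b s|a b c s s' ab IH]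
    [u [v [uv ua vb ->]]] xa y seps yy yb.
  have uu := linkedl uv; have vv := linkedr uv.
  have xu : P x = P u by rewrite xa ua.
  have [g [eqx _ ug]] := transport xx uu xu (fun e => id).
  have xv : N (reorder_act g x - v) = N (u - v) by rewrite ug.
  have supp : supp_le (reorder_act g x) v.
    by apply: (gapped_supp NP (gapped_reorder gx)); rewrite xv.
  have vy : P v = P y by rewrite vb yb.
  have [h [eqgx hv _]] := transport vv yy vy supp.
  exists (g * h)%g; rewrite reorder_actM; split; first exact: unordered_equiv_trans eqgx.
  by rewrite hv xv.
have uu := linkedl uv; have vv := linkedr uv.
have N0 : 0 <= N (u - v) := pnorm_ge0 NP _.
have s0 := segment_chain_ge0 ab.
have [|g [eqx xu]] := IH xa u _ uu ua; first lra.
have xv : N (reorder_act g x - v) <= s + N (u - v).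
  by apply: le_trans (pnorm_triangle NP u _ _) _; rewrite lerD2r.
have supp : supp_le (reorder_act g x) v.
  by apply: (gapped_supp NP (gapped_reorder gx)); exact: le_lt_trans xv seps.
have vy : P v = P y by rewrite vb yb.
have [h [eqgx hv _]] := transport vv yy vy supp.
exists (g * h)%g; rewrite reorder_actM; split; first exact: unordered_equiv_trans eqgx.
by rewrite hv.
Qed.

(** The finitely many preshapes [reorder_act g x] leave a gap [del] in their distances to [y]. A
    chain shorter than both this gap and the gap of [x] makes one of them, equivalent to [x], equal
    to [y]. *)
Lemma segment_metric_eq a b : D a b = 0 -> a = b.
Proof.
move=> ab0; have [x xx xa] := sm_surj H a; have [y yy yb] := sm_surj H b.
have [eps eps0 gx] := gapped_ex x.
have [del del0 delP] := finite_gap (fun g : {perm edge t} => N (reorder_act g x - y)).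
have m0 : 0 < Num.min eps del by rewrite lt_min eps0.
have [s ab sle] := sm_approx H a b (divr_gt0 m0 (ltr0n R 2)).
have : s < Num.min eps del.
  apply: le_lt_trans sle _; rewrite ab0 add0r ltr_pdivrMr // ltr_pMr ?ltr1n //.
rewrite lt_min => /andP[seps sdel].
have [g [eqx xy]] := short_chain_lift ab xx xa gx seps yy yb.
have /delP/(pnorm_eq0 NP)/eqP : `|N (reorder_act g x - y)| < del.
  by rewrite ger0_norm ?pnorm_ge0 //; exact: le_lt_trans xy sdel.
rewrite subr_eq0 => /eqP gxy; rewrite -xa -yb; apply/(sm_kernel H xx yy).
by rewrite -gxy.
Qed.

Lemma segment_metric_is_metric : is_metric D.
Proof.
split; [exact: segment_metric_xx|exact: segment_metric_eq|exact: segment_metric_sym|].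
exact: sm_triangle.
Qed.

End QuotientGeometry.

Lemma ultra_fmap (T U : Type) (f : T -> U) (F : set_system T) :
  UltraFilter F -> UltraFilter (f @ F).
Proof.
move=> FU; split; first exact: fmap_proper_filter.
move=> G GP FG; apply/seteqP; split=> // A GA.
have [//|nA] := in_ultra_setVsetC (f @^-1` A) FU.
have /filter_ex[y []] : G (A `&` ~` A) by apply: filterI => //; exact: FG.
by [].
Qed.

(** * Properness, completeness and contractibility *)

Section SegmentMetricTopology.
Context {R : realType} {n d : nat} {t : btree} {Q : choiceType}.
Local Notation X := {ffun edge t -> 'M[R]_(n, d)}.
Context {EE : {set {set edge t}}} {N : X -> R} {P : X -> Q} {D : Q -> Q -> R}.
Hypothesis H : segment_metric EE N P D.
Local Notation linked := (linked EE).
Let NP := sm_norm H.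
Let M : metricType R := metric_space (segment_metric_is_metric H).
Implicit Types (x y z : X) (a b c : Q).

Let representatives : exists rep : Q -> X, forall a, linked (rep a) (rep a) /\ P (rep a) = a.
Proof.
suff /choice[rep repP] : forall a, exists x, linked x x /\ P x = a by exists rep.
by move=> a; have [x xx xa] := sm_surj H a; exists x.
Qed.

Lemma linked00 : linked (0 : X) (0 : X).
Proof.
have /finset.set0Pn[E1 E1E] := sm_nonempty H.
by exists E1 => // e _; rewrite ffunE.
Qed.

Lemma pnorm_quotient x y : linked x x -> linked y y -> P x = P y -> N x = N y.
Proof.
move=> xx yy /(sm_kernel H xx yy)/unordered_equiv_perm[g [-> _]].
by rewrite (pnorm_reorder NP).
Qed.

(** The norm is constant on classes and varies along a link by at most the cost of the link. *)
Lemma pnorm_quotient_le x y : linked x x -> linked y y -> N x <= N y + D (P x) (P y).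
Proof.
move=> xx yy; have [rep repP] := representatives.
have repN z : linked z z -> N (rep (P z)) = N z.
  by move=> zz; have [rr rz] := repP (P z); exact: pnorm_quotient.
apply/ler_addgt0Pr => eta /(sm_approx H (P x) (P y))[s xy sle].
have := @chain_bound _ _ _ (fun a b => N (rep a) - N (rep b)) _ _ _ _ _ xy.
rewrite /= !repN // => bound; have : N x - N y <= s; last by lra.
apply: bound => [b a c|]; first by lra.
- move=> a b s' [u [v [uv <- <- ->]]]; rewrite !repN; [|exact: linkedr uv|exact: linkedl uv].
  by have := pnormD NP (u - v) v; rewrite subrK; lra.
Qed.

(** Scaling commutes with permuting edges and does not enlarge supports, so the permutation carrying
    [x] to [y] also serves the scaled preshapes. *)
Lemma quotient_scale (c : R) x y : linked x x -> linked y y -> P x = P y -> P (c *: x) = P (c *: y).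
Proof.
move=> xx yy xy.
have scale_linked z : linked z z -> linked (c *: z) (c *: z).
  by move=> zz; apply: linkedl (linked_supp _ zz); exact: supp_leZ.
apply/(sm_kernel H (scale_linked _ xx) (scale_linked _ yy)).
move/(sm_kernel H xx yy)/unordered_equiv_perm: xy => [g [-> gP]].
by rewrite -reorder_actZ; apply: gP; exact: supp_leZ.
Qed.

Lemma segment_metric_scale (c : R) x y : linked x x -> linked y y -> `|c| <= 1 ->
  D (P (c *: x)) (P (c *: y)) <= D (P x) (P y).
Proof.
move=> xx yy c1; have [rep repP] := representatives.
have repZ z : linked z z -> P (c *: rep (P z)) = P (c *: z).
  by move=> zz; have [rr rz] := repP (P z); exact: quotient_scale.
apply/ler_addgt0Pr => eta /(sm_approx H (P x) (P y))[s xy]; apply: le_trans.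
have := @chain_bound _ _ _ (fun a b => D (P (c *: rep a)) (P (c *: rep b))) _ _ _ _ _ xy.
rewrite /= !repZ //; apply.
- by move=> b a b'; exact: (sm_triangle H).
- move=> a b s' [u [v [uv <- <- ->]]]; rewrite !repZ; [|exact: linkedr uv|exact: linkedl uv].
  apply: (@le_trans _ _ (N (c *: u - c *: v))).
    apply: (sm_segment H); apply: linked_sub uv _ => e u0 v0.
    by rewrite !ffunE u0 v0 !scaler0.
  by rewrite -scalerBr (pnormZ NP) ler_piMl // pnorm_ge0.
Qed.

(** Along an ultrafilter the coordinates of chosen representatives are bounded by the norm, hence
    converge to those of some [x]. Representatives close to [x] have at least its support, so they
    are linked to [x], and convergence of norms passes to [D]. *)
Lemma quotient_ball_compact r : compact [set a : M | D a (P 0) <= r].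
Proof.
have [rep repP] := representatives.
rewrite compact_ultra => F FU FB.
pose I : finType := (edge t * ('I_n * 'I_d))%type.
pose co (p : I) (a : M) : R := rep a p.1 p.2.1 p.2.2.
have lim p : exists l : R, co p @ F --> l.
  have FI : F (co p @^-1` `[- r, r]).
    apply: filterS FB => a /= ar; rewrite in_itv /= -ler_norml.
    apply: le_trans (pnorm_ge_coord NP _ _ _ _) _.
    have [aa aE] := repP a.
    by have := pnorm_quotient_le aa linked00; rewrite aE pnorm0 // add0r => /le_trans; apply.
  have := @segment_compact R (- r) r; rewrite compact_ultra => /(_ (co p @ F) _ FI)[].
    exact: ultra_fmap.
  by move=> l [_ lP]; exists l.
have {lim}[l lP] := choice lim.
pose x : X := [ffun e => \matrix_(i, j) l (e, (i, j))].
have nearx eta : 0 < eta -> \forall a \near F, N (x - rep a) < eta.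
  (* One more than the number of coordinates makes the final bound strict, even without
     coordinates. *)
  move=> eta0; pose del := eta / #|I|.+1%:R.
  have del0 : 0 < del by rewrite divr_gt0.
  have : \forall a \near F, forall p, `|l p - co p a| < del.
    by apply: filter_forall => p; have /cvgrPdist_lt/(_ _ del0) := lP p.
  apply: filterS => a ap; apply: le_lt_trans (pnorm_le_sum NP _) _.
  apply: (@le_lt_trans _ _ (\sum_(p : I) del)).
    by apply: ler_sum => -[e [i j]] _ /=; rewrite !ffunE !mxE; exact: ltW (ap (e, (i, j))).
  rewrite sumr_const -mulr_natr /del -mulrA gtr_pMr // mulrC ltr_pdivrMr // mul1r.
  by rewrite ltr_nat.
have [eps eps0 gx] := gapped_ex x.
have linkedx : \forall a \near F, linked x (rep a).
  apply: filterS (nearx _ eps0) => a xa; have [aa _] := repP a.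
  by apply: linked_supp aa; exact: gapped_supp xa.
have nearPx eta : 0 < eta -> \forall a \near F, D (P x) a < eta.
  move=> eta0; near=> a.
  have [_ {1}<-] := repP a; apply: le_lt_trans (sm_segment H _) _; last by near: a; exact: nearx.
  by near: a.
exists (P x); split => /=.
  apply/ler_addgt0Pr => eta eta0.
  have [a [xa ar]] := filter_ex (@filterI _ F _ _ _ (nearPx _ eta0) FB).
  by apply: le_trans (sm_triangle H a _ _) _; rewrite addrC lerD // ltW.
apply/fcvg_ballP => eta eta0; rewrite ballEmdist; exact: nearPx.
Unshelve. all: by end_near. Qed.

Lemma segment_metric_proper : proper_space M.
Proof.
move=> A clA [r Ar]; have [->|/set0P[a Aa]] := eqVneq A set0; first exact: compact0.
apply: (subclosed_compact clA (@quotient_ball_compact (r + D a (P 0)))) => b Ab /=.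
by apply: le_trans (sm_triangle H a _ _) _; rewrite lerD2r; exact: Ar.
Qed.

(** A Cauchy filter eventually stays in a compact ball, and it converges to any cluster point
    there. *)
Lemma segment_metric_complete : complete_space M.
Proof.
move=> F FF /cauchyP Fc.
have [a Fa] := Fc 1 ltr01.
have [|p [_ clp]] := @quotient_ball_compact (1 + D a (P 0)) F FF.
  apply: filterS Fa => b; rewrite ballEmdist /= => /ltW ab.
  apply: le_trans (sm_triangle H a _ _) _; rewrite lerD2r.
  by rewrite (segment_metric_sym H).
exists p; apply/fcvg_ballP => eps eps0; have eps3 : 0 < eps / 3 by rewrite divr_gt0.
have [b Fb] := Fc _ eps3.
have [c [bc pc]] := clp _ _ Fb (nbhsx_ballx p _ eps3).
near=> u; have bu : ball b (eps / 3) u by near: u.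
have -> : eps = eps / 3 + eps / 3 + eps / 3 by lra.
by apply: ball_triangle bu; apply: ball_triangle pc _; exact: ball_sym.
Unshelve. all: by end_near. Qed.

Lemma segment_metric_contractible : contractible_space M.
Proof.
have [rep repP] := representatives.
exists (P 0), (fun p : M * R => P ((1 - p.2) *: rep p.1) : M); split.
- apply/subspace_continuousP => -[a s] /=; rewrite in_itv /= => /andP[s0 s1].
  have [aa aE] := repP a.
  apply/cvg_ballP => eps eps0; rewrite near_withinE.
  have eps2 : 0 < eps / 2 by rewrite divr_gt0.
  have NaP : 0 < N (rep a) + 1 by have := pnorm_ge0 NP (rep a); lra.
  have del0 : 0 < eps / 2 / (N (rep a) + 1) by rewrite divr_gt0.
  have nearp : \forall p \near nbhs ((a, s) : M * R),
      ball (a : M) (eps / 2) p.1 /\ ball s (eps / 2 / (N (rep a) + 1)) p.2.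
    exists (ball (a : M) (eps / 2), ball s (eps / 2 / (N (rep a) + 1))).
      by split; exact: nbhsx_ballx.
    by move=> p [].
  near=> p => /=.
  have [pa ps] : ball (a : M) (eps / 2) p.1 /\ ball s (eps / 2 / (N (rep a) + 1)) p.2.
    by near: p; exact: nearp.
  rewrite in_itv /= => /andP[p0 p1]; rewrite ballEmdist /=.
  have [pp pE] := repP p.1.
  (* The intermediate point first changes only the scale, along a segment, and then only the class,
     where scaling is 1-Lipschitz. *)
  apply: le_lt_trans (sm_triangle H (P ((1 - p.2) *: rep a)) _ _) _.
  have -> : eps = eps / 2 + eps / 2 by lra.
  apply: ltr_leD.
    apply: (@le_lt_trans _ _ (N ((1 - s) *: rep a - (1 - p.2) *: rep a))).
      apply: (sm_segment H); apply: linked_sub aa _ => e a0 _.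
      by rewrite !ffunE a0 !scaler0.
    rewrite -scalerBl (pnormZ NP) opprB addrC addrA subrK.
    move: ps; rewrite /ball /= distrC ltr_pdivlMr // mulrDr mulr1.
    have := normr_ge0 (p.2 - s); lra.
  apply: le_trans (segment_metric_scale aa pp _) _.
    by rewrite ger0_norm; lra.
  by rewrite aE pE; move: pa; rewrite ballEmdist => /ltW.
- by move=> a /=; rewrite subr0 scale1r; have [] := repP a.
- by move=> a /=; rewrite subrr scale0r.
Unshelve. all: by end_near. Qed.

End SegmentMetricTopology.

(** The straight segment stays in the common coordinate subspace, so any two of its points are
    linked. *)
Lemma segment_unit_speed (R : realType) (n d : nat) (t : btree)
    (N : {ffun edge t -> 'M[R]_(n, d)} -> R) (EE : {set {set edge t}})
    (T : Type) (rho : T -> T -> R) (q : {ffun edge t -> 'M[R]_(n, d)} -> T) :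
  preshape_norm N ->
  (forall x y, linked EE x y -> rho (q x) (q y) <= N (x - y)) ->
  forall x y, linked EE x y -> unit_speed_joined rho (q x) (q y) (N (x - y)).
Proof.
move=> NP rho_le x y xy; split; first exact: pnorm_ge0.
exists (fun s => q (x + (s / N (x - y)) *: (y - x))); split.
- by rewrite mul0r scale0r addr0.
(* For a degenerate segment the division by 0 gives 0, and [x = y]. *)
- have [xy0|xyN0] := eqVneq (N (x - y)) 0.
    by rewrite xy0 mul0r scale0r addr0; congr q; apply/eqP; rewrite -subr_eq0 (pnorm_eq0 NP xy0).
  by rewrite divff // scale1r addrC subrK.
- move=> s u s0 su _; apply: le_trans (rho_le _ _ _) _.
    by apply: linked_sub xy _ => e x0 y0; rewrite !ffunE x0 y0 subrr !scaler0 addr0.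
  rewrite opprD addrACA subrr add0r -scalerBl -mulrBl (pnormZ NP) (pnormB NP y).
  rewrite normrM normfV (ger0_norm (pnorm_ge0 NP _)) distrC ger0_norm ?subr_ge0 //.
  have [->|xyN0] := eqVneq (N (x - y)) 0; first by rewrite mulr0 subr_ge0.
  by rewrite divfK.
Qed.

(** * Existence of geodesics *)

Section SegmentMetricGeodesics.
Context {R : realType} {n d : nat} {t : btree} {Q : choiceType}.
Local Notation X := {ffun edge t -> 'M[R]_(n, d)}.
Context {EE : {set {set edge t}}} {N : X -> R} {P : X -> Q} {D : Q -> Q -> R}.
Hypothesis H : segment_metric EE N P D.
Let M : metricType R := metric_space (segment_metric_is_metric H).

Lemma chain_unit_speed a b s : chain (segment_link EE N P) a b s -> unit_speed_joined D a b s.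
Proof.
have seg a' b' s' : segment_link EE N P a' b' s' -> unit_speed_joined D a' b' s'.
  move=> [x [y [xy <- <- ->]]].
  exact: segment_unit_speed (sm_norm H) (sm_segment H) _ _ xy.
elim=> {a b s} [a b s /seg//|a b c s s' _ ab /seg bc].
exact: unit_speed_joined_trans (sm_triangle H) ab bc.
Qed.

(* A geodesic is a pointwise limit, along an ultrafilter, of paths whose
   Lipschitz constants tend to the distance; the paths stay in a compact ball. *)
Lemma segment_metric_geodesic : geodesic_space M.
Proof.
move=> a b; pose L := D a b.
have DT := sm_triangle H; have DC := segment_metric_sym H.
have D0 := segment_metric_ge0 H.
(* Two thirds of the error pay for the limits at the endpoints, one for the excess Lipschitz
   constant. *)
have arith (p q r v l m e : R) : p < e / 3 -> q < e / 3 -> m <= r -> r < e / 3 ->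
    v <= l + m -> p + (v + q) <= l + e by lra.
have approx (k : nat) : exists g : R -> Q, [/\ g 0 = a, g 1 = b &
    forall s u : R, 0 <= s -> s <= u -> u <= 1 -> D (g s) (g u) <= (L + k.+1%:R^-1) * (u - s)].
  have k0 : 0 < k.+1%:R^-1 :> R by rewrite invr_gt0.
  have [l ab lL] := sm_approx H a b k0.
  have [g [g0 g1 gL]] := unit_speed_joined_rescale (chain_unit_speed ab).
  exists g; split=> // s u s0 su u1; apply: le_trans (gL _ _ s0 su u1) _.
  by rewrite ler_wpM2r // subr_ge0.
have {approx}[g gP] := choice approx.
have [U [UU Uoo]] := ultraFilterLemma (eventually_filter : ProperFilter eventually).
have lim u : exists p : M, u \in `[0, 1] -> (fun k => g k u : M) @ U --> p.
  (* Outside the unit interval [a] is only a default. *)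
  have [u01|] := boolP (u \in `[0, 1]); last by exists a.
  move: (u01); rewrite in_itv /= => /andP[u0 u1].
  have FU : U [set k | D (g k u) (P 0) <= L + 1 + D a (P 0)].
    apply: filterE => k /=; have [g0 _ gL] := gP k.
    apply: le_trans (DT a _ _) _; rewrite lerD2r DC -{1}g0.
    apply: le_trans (gL _ _ (lexx _) u0 u1) _; rewrite subr0.
    apply: (@le_trans _ _ (L + k.+1%:R^-1)).
      by rewrite ler_piMr // addr_ge0 ?invr_ge0 //; exact: D0.
    by rewrite lerD2l invf_le1 // ler1n.
  have := @quotient_ball_compact _ _ _ _ _ _ _ _ _ H (L + 1 + D a (P 0)).
  rewrite compact_ultra => /(_ ((fun k => g k u : M) @ U) _ FU)[].
    exact: ultra_fmap.
  by move=> p [_ gp]; exists p.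
have {lim}[f fP] := choice lim.
have near_f u eta : 0 <= u -> u <= 1 -> 0 < eta -> \forall k \near U, D (f u) (g k u) < eta.
  move=> u0 u1 eta0; have /fP/cvg_ball/(_ _ eta0) : u \in `[0, 1] by rewrite in_itv /= u0.
  by rewrite ballEmdist.
have near_L (eta : R) : 0 < eta -> \forall k \near U, k.+1%:R^-1 < eta.
  by move=> eta0; apply: Uoo; exact: near_infty_natSinv_lt (PosNum eta0).
have f0 : f 0 = a.
  apply: (segment_metric_eq H); apply/eqP; rewrite eq_le D0 andbT.
  apply/ler_addgt0Pr => eta eta0; rewrite add0r.
  have [k] := filter_ex (near_f 0 eta (lexx _) ler01 eta0).
  by have [-> _ _] := gP k; move/ltW.
have f1 : f 1 = b.
  apply: (segment_metric_eq H); apply/eqP; rewrite eq_le D0 andbT.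
  apply/ler_addgt0Pr => eta eta0; rewrite add0r.
  have [k] := filter_ex (near_f 1 eta ler01 (lexx _) eta0).
  by have [_ -> _] := gP k; move/ltW.
have fL s u : 0 <= s -> s <= u -> u <= 1 -> D (f s) (f u) <= L * (u - s).
  move=> s0 su u1; apply/ler_addgt0Pr => eta eta0.
  have eta3 : 0 < eta / 3 by rewrite divr_gt0.
  have [k [[sk uk] ke]] := filter_ex (filterI (filterI
    (near_f s _ s0 (le_trans su u1) eta3) (near_f u _ (le_trans s0 su) u1 eta3)) (near_L _ eta3)).
  have [_ _ /(_ _ _ s0 su u1)] := gP k; rewrite mulrDl => gsu.
  have kus : k.+1%:R^-1 * (u - s) <= k.+1%:R^-1 :> R.
    by rewrite ler_piMr ?invr_ge0 // lerBlDl ler_wpDl.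
  apply: le_trans (DT (g k s) _ _) _; apply: le_trans (lerD (lexx _) (DT (g k u) _ _)) _.
  rewrite (DC (g k u) (f u)); exact: arith sk uk kus ke gsu.
exists f; split; first exact: lipschitz_is_path fL.
apply/eqP; rewrite eq_le lipschitz_path_length //=.
by have := path_length_ge D f; rewrite f0 f1.
Qed.

Lemma segment_metric_properties : metric_contractible_complete_proper_geodesic D.
Proof.
exists (segment_metric_is_metric H); split.
- exact: segment_metric_contractible.
- exact: segment_metric_complete.
- exact: segment_metric_proper.
- exact: segment_metric_geodesic.
Qed.

End SegmentMetricGeodesics.

(** * The length metric of a restricted preshape space *)

Section RestrictedLengthMetric.
Context {R : realType} {n d : nat} {t : btree}.
Local Notation X := {ffun edge t -> 'M[R]_(n, d)}.
Context {EE : {set {set edge t}}} {N : X -> R}.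
Hypothesis NP : preshape_norm N.
Hypothesis EE0 : EE != finset.set0.
Local Notation T := (@restricted_preshape R n d t EE).
Local Notation linked := (linked EE).
Let rho (u v : T) : R := N (val u - val v).
Let dZ : T -> T -> R := length_metric rho.

Lemma linked_val (u : T) : linked (val u) (val u).
Proof. exact/in_restrictedP/(valP u). Qed.

Lemma restricted0 : in_restricted EE (0 : X).
Proof.
have /finset.set0Pn[E1 E1E] := EE0.
by apply/in_restrictedP; exists E1 => // e _; rewrite ffunE.
Qed.

(** A retraction with default 0, so that the projection to the restricted quotient is defined on all
    of [X], as [segment_metric] expects. *)
Definition restrict_preshape (x : X) : T := insubd (Sub (0 : X) restricted0) x.

Lemma restrict_preshapeK x : linked x x -> val (restrict_preshape x) = x.
Proof. by move=> /in_restrictedP xx; rewrite /restrict_preshape insubdK. Qed.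

Lemma restrict_preshape_val u : restrict_preshape (val u) = u.
Proof. by apply: val_inj; rewrite restrict_preshapeK //; exact: linked_val. Qed.

Let rho_ge0 u v : 0 <= rho u v. Proof. exact: pnorm_ge0. Qed.

Let rho_sym u v : rho u v = rho v u. Proof. exact: pnormB. Qed.

Let rho_triangle v u w : rho u w <= rho u v + rho v w. Proof. exact: pnorm_triangle. Qed.

Let path_lengths u v := [set path_length rho gamma | gamma in [set g | is_path rho u v g]].

Let inf_ge0 u v : (0 <= ereal_inf (path_lengths u v))%E.
Proof.
apply: le_ereal_inf_tmp => _ [gamma _ <-]; apply: le_trans (path_length_ge _ _).
by rewrite lee_fin.
Qed.

Let inf_le u v l : unit_speed_joined rho u v l -> (ereal_inf (path_lengths u v) <= l%:E)%E.
Proof.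
move=> uv; have [g [g0 g1 gL]] := unit_speed_joined_rescale uv.
apply: ge_ereal_inf; exists (path_length rho g); last exact: lipschitz_path_length.
by exists g => //; exact: lipschitz_is_path gL.
Qed.

Lemma linked_unit_speed u v : linked (val u) (val v) -> unit_speed_joined rho u v (rho u v).
Proof.
move=> uv; rewrite -{1}[u]restrict_preshape_val -{1}[v]restrict_preshape_val.
apply: segment_unit_speed uv => // x y xy.
by rewrite /rho !restrict_preshapeK //; [exact: linkedr xy|exact: linkedl xy].
Qed.

(* The broken segment through 0 is a path of finite length. *)
Let inf_fin u v : ereal_inf (path_lengths u v) \is a fin_num.
Proof.
have link0 (w : T) : linked (val w) (val (restrict_preshape 0)).
  rewrite restrict_preshapeK; last by apply/in_restrictedP; exact: restricted0.
  by apply: linked_sub (linked_val w) _ => e w0 _; rewrite w0 ffunE.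
have u0 := linked_unit_speed (link0 u).
have v0 := linked_unit_speed (linked_sym (link0 v)).
rewrite ge0_fin_numE //; apply: le_lt_trans (ltry _).
exact: inf_le (unit_speed_joined_trans rho_triangle u0 v0).
Qed.

Lemma restricted_dist_ge0 u v : 0 <= dZ u v.
Proof. by apply: fine_ge0; exact: inf_ge0. Qed.

Lemma restricted_dist_le u v : linked (val u) (val v) -> dZ u v <= N (val u - val v).
Proof.
move=> /linked_unit_speed/inf_le uv; rewrite -lee_fin.
by rewrite /dZ /length_metric fineK ?inf_fin.
Qed.

Context {Q : choiceType} (P : X -> Q).

(* Supports can only grow in a small neighbourhood of a point of a path, so
   sufficiently close points of the path lie in a common coordinate subspace. *)
Lemma path_locally_linked u v (gamma : R -> T) s : is_path rho u v gamma -> 0 <= s <= 1 ->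
  exists2 del : R, 0 < del & forall s' : R, 0 <= s' <= 1 -> `|s - s'| < del ->
    linked (val (gamma s)) (val (gamma s')).
Proof.
move=> [_ _ gc] s01; have [eps eps0 gap] := gapped_ex (val (gamma s)).
have := gc s; rewrite in_itv /= => /(_ s01)/cvgrPdist_lt/(_ _ eps0).
rewrite near_withinE => /nbhs_ballP[del /= del0 ball_del]; exists del => // s' s'01 ss'.
apply: linked_supp; last exact: linked_val.
apply: (gapped_supp NP gap).
have := ball_del s' ss'; rewrite /= in_itv /= => /(_ s'01).
by rewrite sub0r normrN ger0_norm // rho_sym.
Qed.

(** Continuous induction: the supremum of the parameters reached by partitions with linked
    consecutive points is itself reached and cannot be less than 1. The cost of the chain is a
    partition sum, hence at most the length of the path. *)
Lemma path_segment_chain u v (gamma : R -> T) : is_path rho u v gamma ->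
  exists2 s, chain (segment_link EE N P) (P (val u)) (P (val v)) s
    & (s%:E <= path_length rho gamma)%E.
Proof.
move=> gpath; have [g0 g1 _] := gpath.
pose psum (l : seq R) := \sum_(0 <= i < size l)
  rho (gamma (nth 1 (0 :: l) i)) (gamma (nth 1 (0 :: l) i.+1)).
pose Pg s := P (val (gamma s)).
pose reached (s : R) := 0 <= s <= 1 /\ exists l : seq R,
  [/\ path <%O 0 l, last 0 l = s & chain (segment_link EE N P) (Pg 0) (Pg s) (psum l)].
have reached0 : reached 0.
  split; first by rewrite lexx ler01.
  (* A chain has at least one link, so the empty partition is given a degenerate one of cost 0. *)
  exists [::]; split=> //; apply: chain_link; exists (val (gamma 0)), (val (gamma 0)).
  split=> //; first exact: linked_val.
  by rewrite /psum /= big_geq // subrr pnorm0.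
have extend s s' : reached s -> s < s' -> s' <= 1 ->
    linked (val (gamma s)) (val (gamma s')) -> reached s'.
  move=> [/andP[s0 _] [l [lpath ls lchain]]] ss' s'1 gg; split.
    by rewrite s'1 andbT (le_trans s0 (ltW ss')).
  exists (rcons l s'); split; rewrite ?last_rcons ?rcons_path ?lpath ?ls //.
  have -> : psum (rcons l s') = psum l + rho (gamma s) (gamma s').
    have nth_l i : (i <= size l)%N -> nth 1 (0 :: rcons l s') i = nth 1 (0 :: l) i.
      by move=> il; rewrite -rcons_cons nth_rcons /= ltnS il.
    rewrite /psum size_rcons big_nat_recr //=; congr (_ + rho (gamma _) (gamma _)).
    - apply: eq_big_nat => i /andP[_ il]; congr (rho (gamma _) (gamma _)).
        exact: nth_l (ltnW il).
      exact: nth_l il.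
    - by rewrite [LHS]nth_l // -[in RHS]ls (last_nth 1).
    - by rewrite nth_rcons ltnn eqxx.
  apply: chain_rcons lchain _.
  by exists (val (gamma s)), (val (gamma s')).
have sup_reached : has_sup [set s | reached s].
  by split; [exists 0|exists 1 => s [/andP[]]].
set tau := sup [set s | reached s].
have tau01 : 0 <= tau <= 1.
  apply/andP; split; first exact: ub_le_sup sup_reached.2 _ reached0.
  by apply: ge_sup; [exists 0|move=> s [/andP[]]].
have [del del0 linked_tau] := path_locally_linked gpath tau01.
have reached_tau : reached tau.
  have [s rs taus] := sup_adherent del0 sup_reached.
  have stau : s <= tau by exact: ub_le_sup sup_reached.2 _ rs.
  move: stau; rewrite le_eqVlt => /orP[/eqP <-//|stau].
  have [s01 _] := rs.
  apply: (extend _ _ rs stau); first by case/andP: tau01.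
  apply/linked_sym/linked_tau => //.
  by rewrite -/tau in taus; rewrite ger0_norm; lra.
have tau1 : tau = 1.
  have /andP[tau0 tau1] := tau01; apply/eqP; rewrite eq_le tau1 /= leNgt; apply/negP => tau_lt1.
  (* Half of [del] keeps the new point strictly within the neighbourhood linked to [tau]. *)
  pose tau' := Num.min 1 (tau + del / 2).
  have del2 : 0 < del / 2 by rewrite divr_gt0.
  have tt' : tau < tau' by rewrite lt_min tau_lt1 ltrDl.
  have tau'1 : tau' <= 1 by rewrite ge_min lexx.
  have : reached tau'.
    apply: (extend _ _ reached_tau tt' tau'1); apply: linked_tau.
      by rewrite tau'1 (le_trans tau0 (ltW tt')).
    have t'del : tau' <= tau + del / 2 by rewrite ge_min lexx orbT.
    rewrite distrC ger0_norm ?subr_ge0 ?(ltW tt') //; lra.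
  by move=> /(ub_le_sup sup_reached.2); rewrite leNgt tt'.
have [_ [l [lpath ls lchain]]] := reached_tau; rewrite tau1 in ls lchain.
exists (psum l); first by rewrite -g0 -g1.
apply: ereal_sup_ubound; exists l => //.
by split=> //; rewrite ls.
Qed.

Lemma restricted_dist_approx :
  approximated_by (segment_link EE N P) (fun u => P (val u)) dZ.
Proof.
move=> u v eta eta0.
have [_ [gamma gpath <-] len] := lb_ereal_inf_adherent eta0 (inf_fin u v).
have [s uv sle] := path_segment_chain gpath; exists s => //.
rewrite -lee_fin EFinD /dZ /length_metric fineK ?inf_fin //.
exact: le_trans sle (ltW len).
Qed.

End RestrictedLengthMetric.

(** * The two iterated quotients as segment metrics *)

Lemma unordered_shape_segment_metric (R : realType) (n d : nat) (t : btree)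
    (N : {ffun edge t -> 'M[R]_(n, d)} -> R) : preshape_norm N ->
  segment_metric [set [set: edge t]%SET]%SET N
    (fun x => \pi_{eq_quot reordering_equiv} (\pi_{eq_quot shape_equiv} x))
    (unordered_shape_dist (fun x y => N (x - y))).
Proof.
move=> NP.
have rho0 (x y : {ffun edge t -> 'M[R]_(n, d)}) : 0 <= N (x - y) by exact: pnorm_ge0.
have rho0' := quotient_dist_ge0 (e := shape_equiv) rho0.
(* The full preshape space is the restricted one for the family consisting of the set of all
   edges. *)
have all_linked (x y : {ffun edge t -> 'M[R]_(n, d)}) : linked [set [set: edge t]%SET]%SET x y.
  by exists [set: edge t]%SET => [|e]; rewrite inE.
split=> //.
- by apply/finset.set0Pn; exists [set: edge t]%SET; rewrite inE.
- by move=> a; exists (repr (repr a)); rewrite // !reprK.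
- by move=> x y _ _; split=> [/eqmodP|xy]; last exact/eqmodP.
- by move=> b a c; exact: quotient_dist_triangle.
- move=> x y _.
  apply: le_trans (quotient_dist_pi shape_equiv rho0 x y).
  exact: (quotient_dist_pi _ rho0').
- apply: quotient_dist_approx => //; apply: quotient_dist_approx => // x y eta eta0.
  exists (N (x - y)); last by rewrite lerDl ltW.
  by apply: chain_link; exists x, y.
Qed.

Lemma restricted_shape_segment_metric (R : realType) (n d : nat) (t : btree)
    (N : {ffun edge t -> 'M[R]_(n, d)} -> R) (EE : {set {set edge t}})
    (NP : preshape_norm N) (EE0 : EE != finset.set0) :
  segment_metric EE N
    (fun x => \pi_{eq_quot (@restricted_reordering_equiv R n d t EE)}
       (\pi_{eq_quot (@restricted_shape_equiv R n d t EE)} (restrict_preshape EE0 x)))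
    (@restricted_unordered_shape_dist R n d t EE (fun x y => N (x - y))).
Proof.
have rho0 : forall u v, 0 <= @restricted_preshape_dist R n d t EE (fun x y => N (x - y)) u v.
  by move=> u v; exact: restricted_dist_ge0.
have rho0' := quotient_dist_ge0 (e := @restricted_shape_equiv R n d t EE) rho0.
(* The inclusion of shapes is defined by a chosen representative but does not depend on it. *)
have incl_pi (u : restricted_preshape R n d EE) :
    restricted_shape_incl (\pi_{eq_quot (@restricted_shape_equiv R n d t EE)} u)
    = \pi_{eq_quot shape_equiv} (val u).
  by apply/eqmodP; have /eqmodP := reprK (\pi_{eq_quot (@restricted_shape_equiv R n d t EE)} u).
split=> //.
- move=> a; exists (val (repr (repr a))); first exact: linked_val.
  by rewrite restrict_preshape_val !reprK.
- move=> x y xx yy; have -> : unordered_equiv x y =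
    @restricted_reordering_equiv R n d t EE
      (\pi_{eq_quot (@restricted_shape_equiv R n d t EE)} (restrict_preshape EE0 x))
      (\pi_{eq_quot (@restricted_shape_equiv R n d t EE)} (restrict_preshape EE0 y)) :> Prop.
    rewrite /restricted_reordering_equiv /= /restrict_rel !incl_pi.
    by rewrite !restrict_preshapeK.
  by split=> [/eqmodP|xy]; last exact/eqmodP.
- by move=> b a c; exact: quotient_dist_triangle.
- move=> x y xy.
  apply: le_trans (quotient_dist_pi _ rho0' _ _) _.
  apply: le_trans (quotient_dist_pi _ rho0 _ _) _.
  have xK := restrict_preshapeK EE0 (linkedl xy).
  have yK := restrict_preshapeK EE0 (linkedr xy).
  rewrite -[in leRHS]xK -[in leRHS]yK; apply: restricted_dist_le => //.
  by rewrite xK yK.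
- apply: quotient_dist_approx => //; apply: quotient_dist_approx => // u v eta eta0.
  have [s] := @restricted_dist_approx _ _ _ _ _ _ NP EE0 _
    (fun x => \pi_{eq_quot (@restricted_reordering_equiv R n d t EE)}
       (\pi_{eq_quot (@restricted_shape_equiv R n d t EE)} (restrict_preshape EE0 x))) u v eta eta0.
  by rewrite !restrict_preshape_val; exists s.
Qed.

Theorem theorem15 (R : realType) (d n : nat) (t : btree)
    (dist : {ffun edge t -> 'M[R]_(n, d)} -> {ffun edge t -> 'M[R]_(n, d)} -> R)
    (d_ge1 : (1 <= d)%N) (n_ge1 : (1 <= n)%N) (edges_nonempty : (0 < #|edge t|)%N)
    (distE : dist = d1 \/ dist = d2) :
  metric_contractible_complete_proper_geodesic (unordered_shape_dist dist) /\
  (forall EE : {set {set edge t}}, restricting_family EE -> saturated EE ->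
     metric_contractible_complete_proper_geodesic
       (@restricted_unordered_shape_dist R n d t EE dist)).
Proof.
have [N NP ->] := preshape_normP distE; split.
  exact: segment_metric_properties (unordered_shape_segment_metric NP).
move=> EE [EE0 _] _.
exact: segment_metric_properties (restricted_shape_segment_metric NP EE0).
Qed.
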